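(* Assume that for all $i,j$ the function $c(\cdot,i,j)$ has finite support, that Assumption A holds, and that $m_1=\cdots=m_p=m>1$. Fix a starting color $i_0$, and for $n\ge1$ let $A_n\subset\mathbb Z^d$ be the set of $x$ such that, for some color $i$, $(x,i)$ can be reached with positive probability by the killed random walk started at $(0,i_0)$ in $k$ steps for some $1\le k\le n$. Let $K_m=\{ru:u\in\mathbb S^{d-1},\ 0\le r\le\frac1{\Gamma_m^{-1}(u)\cdot u}\}$ be the region delimited by the limit curve of the sandpile. Then, as $m\to+\infty$, the rescaled shape $(\log m)\cdot K_m$ converges to the limit of $\frac1n\cdot A_n$ as $n\to\infty$: there is a compact set $\mathcal L\subset\mathbb R^d$ with $$\lim_{m\to\infty}d_H\bigl((\log m)\cdot K_m,\mathcal L\bigr)=0\qquad\text{and}\qquad\lim_{n\to\infty}d_H\bigl(\tfrac1n\cdot A_n,\mathcal L\bigr)=0 .$$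
   Context: Setting. $d,p\ge1$ are integers. For $x\in\mathbb Z^d$, $i,j\in\{1,\dots,p\}$ let $c(x,i,j)\ge 0$ (fixed, not depending on $m$), with $0<\sigma_i:=\sum_{(y,j)}c(y,i,j)<\infty$, and let $m_i\ge1$ be leakiness parameters. Put $\mu_{i,j}(x)=\frac{c(x,i,j)}{m_i\sigma_i}$. The killed random walk (KRW) $(X_n)$ on $(\mathbb Z^d\times\{1,\dots,p\})\sqcup\{\mathsf k\}$ jumps from $(x,i)$ to $(y,j)$ with probability $\mu_{i,j}(y-x)$ and from $(x,i)$ to the absorbing cemetery $\mathsf k$ with probability $1-\frac1{m_i}$. Assumption A: (1) $m_i>1$ for at least one $i$; (2) the KRW is irreducible: every $(x,j)$ can be reached from every $(0,i)$ with positive probability in some number $n\ge1$ of steps; (3) it is aperiodic: $\gcd\{n\ge1:\mathbb P_{(x,i)}(X_n=(x,i))>0\}=1$ for all $(x,i)$; (4) $\sum_{x}e^{\gamma\|x\|}\mu_{i,j}(x)<\infty$ for all $i,j$ and all $\gamma>0$. The sets $A_n$ do not depend on $m$. For $t\in\mathbb R^d$ let $L\mu(t)$ be the $p\times p$ matrix with entries $\sum_{x\in\mathbb Z^d}e^{t\cdot x}\mu_{i,j}(x)$ and $\rho(t)$ its spectral radius (both depend on $m$); $\partial\mathcal T=\{t:\rho(t)=1\}$. The map $\Gamma_m:\partial\mathcal T\to\mathbb S^{d-1}$, $\Gamma_m(t)=\nabla\rho(t)/\|\nabla\rho(t)\|$, is a homeomorphism (known result), and $\Gamma_m^{-1}(u)\cdot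 u>0$ for all $u$. The boundary of $K_m$ delimits the limit shape, after scaling by $1/\log N$, of the leaky Abelian sandpile with toppling weights $c$ and leakiness $m$ started with $N\to\infty$ grains at the origin. $d_H$ is the Hausdorff distance. *)

(* Defs.v *)
From HB Require Import structures.
From mathcomp Require Import all_boot all_order all_algebra.
From mathcomp Require Import complex.
From mathcomp Require Import all_classical all_reals all_analysis.

Set Implicit Arguments.
Unset Strict Implicit.
Unset Printing Implicit Defensive.

Import Order.TTheory GRing.Theory Num.Theory.
Import numFieldNormedType.Exports.

Local Open Scope classical_set_scope.
Local Open Scope ring_scope.

(* The norm that MathComp-Analysis puts on 'rV[R]_d is the sup norm, so the
   Euclidean structure is defined here. *)

Definition dotp (R : realType) (d : nat) (u v : 'rV[R]_d) : R :=
  \sum_(k < d) u 0 k * v 0 k.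

Definition enorm (R : realType) (d : nat) (u : 'rV[R]_d) : R :=
  Num.sqrt (dotp u u).

Definition usphere (R : realType) (d : nat) : set 'rV[R]_d :=
  [set u | enorm u = 1].

Definition int_vec (R : realType) (d : nat) (x : 'rV[int]_d) : 'rV[R]_d :=
  map_mx intr x.
Arguments int_vec R {d} x.

Definition gradient (R : realType) (d : nat) (f : 'rV[R]_d -> R)
    (t : 'rV[R]_d) : 'rV[R]_d :=
  \row_(k < d) ('D_(delta_mx 0 k) (f : 'rV[R]_d -> R^o) t : R).

Definition scale_set (R : realType) (d : nat) (a : R) (A : set 'rV[R]_d) :
    set 'rV[R]_d :=
  [set a *: x | x in A].

(* Extended-real valued: +oo when neither closed neighbourhood inclusion holds
   for any radius, e.g. when exactly one of the two sets is empty. *)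
Definition hausdorff_dist (R : realType) (d : nat) (A B : set 'rV[R]_d) :
    \bar R :=
  ereal_inf [set e%:E | e in [set e : R | [/\ 0 <= e,
    forall a, A a -> exists2 b, B b & enorm (a - b) <= e &
    forall b, B b -> exists2 a, A a & enorm (a - b) <= e]]].

Definition is_set_gcd (A : set nat) (g : nat) : Prop :=
  (forall n, A n -> (g %| n)%N) /\
  (forall e : nat, (forall n, A n -> (e %| n)%N) -> (e %| g)%N).

(* The moduli are those of the complex eigenvalues. *)
Definition spectral_radius (R : realType) (p : nat) (A : 'M[R]_p) : R :=
  sup [set r : R | exists2 z : R[i],
    eigenvalue (map_mx (real_complex R) A) z & r = Normc.normc z].

Definition total_weight (R : realType) (d p : nat)
    (c : 'rV[int]_d -> 'I_p -> 'I_p -> R) (i : 'I_p) : \bar R :=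
  \esum_(yj in [set: 'rV[int]_d * 'I_p]) (c yj.1 i yj.2)%:E.

Definition jump (R : realType) (d p : nat)
    (c : 'rV[int]_d -> 'I_p -> 'I_p -> R) (m : 'I_p -> R)
    (x : 'rV[int]_d) (i j : 'I_p) : R :=
  c x i j / (m i * fine (total_weight c i)).

(* None is the cemetery. *)
Definition krw_state (d p : nat) := option ('rV[int]_d * 'I_p).

Definition krw_step (R : realType) (d p : nat)
    (c : 'rV[int]_d -> 'I_p -> 'I_p -> R) (m : 'I_p -> R)
    (s s' : krw_state d p) : R :=
  match s, s' with
  | Some (x, i), Some (y, j) => jump c m (y - x) i j
  | Some (_, i), None => 1 - (m i)^-1
  | None, Some _ => 0
  | None, None => 1
  end.

(* krw_prob c m n s s' is the probability, for the walk started at s, that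
   X_n = s'. *)
Fixpoint krw_prob (R : realType) (d p : nat)
    (c : 'rV[int]_d -> 'I_p -> 'I_p -> R) (m : 'I_p -> R) (n : nat)
    (s s' : krw_state d p) : \bar R :=
  match n with
  | 0%N => (s == s')%:R%:E
  | n'.+1 => \esum_(u in [set: krw_state d p])
               ((krw_step c m s u)%:E * krw_prob c m n' u s')%E
  end.

Record assumptionA (R : realType) (d p : nat)
    (c : 'rV[int]_d -> 'I_p -> 'I_p -> R) (m : 'I_p -> R) : Prop := {
  krw_leaky : exists i, 1 < m i;
  krw_irreducible : forall (i j : 'I_p) (x : 'rV[int]_d),
    exists2 n : nat, (1 <= n)%N &
      (0 < krw_prob c m n (Some (0%R, i)) (Some (x, j)))%E;
  krw_aperiodic : forall (x : 'rV[int]_d) (i : 'I_p),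
    is_set_gcd [set n : nat | (1 <= n)%N /\
      (0 < krw_prob c m n (Some (x, i)) (Some (x, i)))%E] 1;
  krw_exp_moments : forall (i j : 'I_p) (gamma : R), 0 < gamma ->
    (\esum_(x in [set: 'rV[int]_d])
       (expR (gamma * enorm (int_vec R x)) * jump c m x i j)%:E < +oo)%E
}.

Definition laplace_mx (R : realType) (d p : nat)
    (c : 'rV[int]_d -> 'I_p -> 'I_p -> R) (m : 'I_p -> R)
    (t : 'rV[R]_d) : 'M[R]_p :=
  \matrix_(i < p, j < p) fine (\esum_(x in [set: 'rV[int]_d])
    (expR (dotp t (int_vec R x)) * jump c m x i j)%:E).

Definition rho (R : realType) (d p : nat)
    (c : 'rV[int]_d -> 'I_p -> 'I_p -> R) (m : 'I_p -> R)
    (t : 'rV[R]_d) : R :=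
  spectral_radius (laplace_mx c m t).

Definition rho_level (R : realType) (d p : nat)
    (c : 'rV[int]_d -> 'I_p -> 'I_p -> R) (m : 'I_p -> R) : set 'rV[R]_d :=
  [set t | rho c m t = 1].

Definition Gamma (R : realType) (d p : nat)
    (c : 'rV[int]_d -> 'I_p -> 'I_p -> R) (m : 'I_p -> R)
    (t : 'rV[R]_d) : 'rV[R]_d :=
  (enorm (gradient (rho c m) t))^-1 *: gradient (rho c m) t.

Definition Gamma_inv (R : realType) (d p : nat)
    (c : 'rV[int]_d -> 'I_p -> 'I_p -> R) (m : 'I_p -> R) :
    'rV[R]_d -> 'rV[R]_d :=
  'pinv_(fun=> 0) (rho_level c m) (Gamma c m).

Definition sandpile_shape (R : realType) (d p : nat)
    (c : 'rV[int]_d -> 'I_p -> 'I_p -> R) (m : 'I_p -> R) : set 'rV[R]_d :=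
  [set v | exists r : R, exists2 u : 'rV[R]_d, usphere u &
    0 <= r <= 1 / dotp (Gamma_inv c m u) u /\ v = r *: u].

Definition reached (R : realType) (d p : nat)
    (c : 'rV[int]_d -> 'I_p -> 'I_p -> R) (m : 'I_p -> R) (i0 : 'I_p)
    (n : nat) : set 'rV[int]_d :=
  [set x | exists i : 'I_p, exists2 k : nat, (1 <= k <= n)%N &
    (0 < krw_prob c m k (Some (0%R, i0)) (Some (x, i)))%E].

(* Main.v *)
(* With equal leakiness parameters the Laplace matrix is 1/m times a matrix B(t)
   that does not depend on m; let r(t) be the Perron eigenvalue of B(t), so that
   rho = r / m. Convexity of log r and a first-order expansion of r show that
   Gamma_m^{-1}(u) is a maximizer of t . u over {r <= m}, hence K_m is the polar
   of {r <= m}.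
   Let H(t) be the supremum of t . x / k over the k-step loops i0 -> i0 with
   displacement x. Testing B(t) on suitable positive vectors gives
   H - C <= log r <= H. As H is positively homogeneous, (log m) K_m is squeezed
   between (log m / (log m + C)) L and L, where L = {v : t . v <= H(t) for all t}.
   Loop averages x / k lie in L, and are dense in it by a separation argument;
   repeating loops, resp. closing walks up to loops, gives A_n / n -> L. *)

Require Import Defs.
From HB Require Import structures.
From mathcomp Require Import all_boot all_order all_algebra.
From mathcomp Require Import complex.
From mathcomp Require Import all_classical all_reals all_analysis.
From mathcomp Require Import lra ring.

Set Implicit Arguments.
Unset Strict Implicit.
Unset Printing Implicit Defensive.

Import Order.TTheory GRing.Theory Num.Theory.
Import numFieldNormedType.Exports.

Local Open Scope classical_set_scope.
Local Open Scope ring_scope.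

(** * Perron-Frobenius theory *)

(** Every estimate on r comes from Collatz-Wielandt quotients: a single positive test vector bounds
    the Perron eigenvalue from one side. In logarithmic coordinates the vectors are explicit: the
    eigenvector at another point (Lipschitz bound), a geometric mean of two eigenvectors
    (convexity), a perturbed eigenvector (derivative), a supremum over walks (upper bound by H). The
    constant C is the absolute logarithm of a lower bound for the positive transition probabilities.
    [Gamma_inv] is a pseudo-inverse that picks some preimage. Hence each unit vector u must be shown
    to have one, and every preimage must be shown to give the same value of t . u. *)

Lemma continuous_sum (T : topologicalType) (R : realType) (I : Type)
    (r : seq I) (f : I -> T -> R) :
  (forall i, continuous (f i)) -> continuous (fun x => \sum_(i <- r) f i x : R).
Proof.
move=> fc x; elim: r => [|i r IH].
  rewrite (_ : (fun _ => _) = cst 0); first exact: cvg_cst.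
  by apply/funext => y; rewrite big_nil.
rewrite (_ : (fun _ => _) = (fun y => f i y + \sum_(j <- r) f j y)).
  by apply: (@cvgD _ R^o _ _ _ (f i)) => //; exact: fc.
by apply/funext => y; rewrite big_cons.
Qed.

Lemma continuous_lincomb (T : topologicalType) (R : realType) (I : Type)
    (r : seq I) (a : I -> R) (f : I -> T -> R) :
  (forall i, continuous (f i)) ->
  continuous (fun x => \sum_(i <- r) a i * f i x : R).
Proof.
move=> fc; apply: continuous_sum => i x.
apply: (@cvgM _ _ _ _ (fun=> a i)); [exact: cvg_cst|exact: fc].
Qed.

Lemma fin_pos_lower_bound (R : realFieldType) (I : finType) (w : I -> R) :
  (forall i, 0 < w i) -> exists2 e, 0 < e & forall i, e <= w i.
Proof.
move=> w0.
have s0 : 0 < 1 + \sum_i (w i)^-1.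
  by rewrite ltr_pwDl// sumr_ge0// => i _; rewrite invr_ge0 ltW.
exists (1 + \sum_i (w i)^-1)^-1; first by rewrite invr_gt0.
move=> i; rewrite -[leRHS]invrK lef_pV2 ?posrE ?invr_gt0//.
rewrite (bigD1 i)//= addrCA lerDl addr_ge0// sumr_ge0// => j _.
by rewrite invr_ge0 ltW.
Qed.

Lemma continuous_norm_add (T : topologicalType) (R : realType) (f : T -> R) :
  continuous f -> continuous (fun x => `|f x| + f x : R).
Proof.
move=> fc x; apply: (@cvgD _ R^o _ _ _ (fun x => `|f x|)); last exact: fc.
by apply: (@cvg_norm _ R^o); exact: fc.
Qed.

(** Path-free form of strong connectivity of the graph of positive entries, ready to be applied as
    an induction principle on indices. *)
Definition irreducible_mx (R : numDomainType) n (A : 'M[R]_n) :=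
  forall P : 'I_n -> Prop, (exists i, P i) ->
    (forall i j, 0 < A i j -> P j -> P i) -> forall i, P i.

Lemma irreducible_mx_succ (R : numDomainType) n (A : 'M[R]_n)
    (P : 'I_n -> Prop) :
  irreducible_mx A -> (exists i, P i) ->
  (forall i j, 0 < A i j -> P i -> P j) -> forall i, P i.
Proof.
move=> irr [i0 Pi0] succ i; apply: contrapT => nPi.
suff : ~ P i0 by [].
apply: (irr (fun k => ~ P k)) => [|k l Akl nPl Pk]; first by exists i.
by apply: nPl; exact: succ Akl Pk.
Qed.

Section perron.
Variables (R : realType) (n : nat) (A : 'M[R]_n).
Hypotheses (n_gt0 : (0 < n)%N) (A_ge0 : forall i j, 0 <= A i j).
Hypothesis A_irr : irreducible_mx A.

Let F (v : 'I_n -> R) i := \sum_j A i j * v j.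
(** Adding the identity keeps supports from shrinking, so irreducibility alone leads to full
    support, even for a periodic matrix. *)
Let T (v : 'I_n -> R) i := v i + F v i.

Let F_ge0 v : (forall i, 0 <= v i) -> forall i, 0 <= F v i.
Proof. by move=> v0 i; apply: sumr_ge0 => j _; rewrite mulr_ge0. Qed.

Let iterT_ge0 N v : (forall i, 0 <= v i) -> forall i, 0 <= iter N T v i.
Proof. by move=> v0; elim: N => //= N IH i; rewrite addr_ge0// F_ge0. Qed.

Let iterT_pos v : (forall i, 0 <= v i) -> (exists i, 0 < v i) ->
  exists N, forall i, 0 < iter N T v i.
Proof.
move=> v0 [i0 vi0].
have mono N M i : (N <= M)%N -> 0 < iter N T v i -> 0 < iter M T v i.
  move=> /subnK <-; elim: (M - N)%N => //= k IH /IH pos.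
  by rewrite ltr_wpDr// F_ge0//; exact: iterT_ge0.
have : forall i, exists N, 0 < iter N T v i.
  apply: A_irr => [|i j Aij [N posN]]; first by exists i0, 0%N.
  exists N.+1 => /=; rewrite ltr_wpDl ?iterT_ge0// /F (bigD1 j)//=.
  rewrite ltr_pwDl ?mulr_gt0// sumr_ge0// => k _.
  by rewrite mulr_ge0// iterT_ge0.
move=> /choice[g gP]; exists (\max_i g i) => i.
by apply: mono (gP i); exact: leq_bigmax.
Qed.

Let simplex : set 'rV[R]_n :=
  [set x | (forall i, 0 <= x 0 i) /\ \sum_i x 0 i = 1].

Let continuous_sum_coord (a : 'I_n -> R) :
  continuous (fun x : 'rV[R]_n => \sum_i a i * x 0 i : R).
Proof.
apply: continuous_lincomb => i; exact: coord_continuous.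
Qed.

Let simplex_le1 x : simplex x -> forall i, x 0 i <= 1.
Proof.
move=> [x0 <-] i; rewrite (bigD1 i)//= lerDl sumr_ge0//.
Qed.

Let compact_simplex : compact simplex.
Proof.
apply: bounded_closed_compact.
  exists 1; split; first exact: num_real.
  move=> M M1 x sx /=; rewrite [leLHS]/Num.norm/= mx_normrE.
  apply/bigmax_leP; split => [|[i j] _ /=]; first exact: ltW (lt_trans _ M1).
  rewrite ord1 ger0_norm; last by case: sx.
  by rewrite (le_trans _ (ltW M1))// simplex_le1.
have -> : simplex = (\bigcap_(i in [set: 'I_n])
    ((fun x : 'rV[R]_n => x 0 i : R) @^-1` [set t | 0 <= t]))
    `&` ((fun x : 'rV[R]_n => \sum_i 1 * x 0 i : R) @^-1` [set 1]).
  apply/seteqP; split => x /= [h1 h2]; split.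
  - by move=> i _; exact: h1.
  - by rewrite -[RHS]h2; under eq_bigr do rewrite mul1r.
  - by move=> i; exact: h1.
  - by rewrite -[RHS]h2; under [RHS]eq_bigr do rewrite mul1r.
apply: closedI.
  apply: closed_bigI => i _; apply: closed_comp; last exact: closed_ge.
  by move=> x _; exact: coord_continuous.
apply: closed_comp; last exact: closed_eq.
by move=> x _; exact: continuous_sum_coord.
Qed.

(** The eigenvalue is the largest [l] with [l x <= A x] for some [x] in the simplex. If equality
    failed at an optimal [x], iterating [T] would make the inequality strict in every coordinate and
    leave room for a larger [l]. *)
Lemma perron : exists r : R, exists2 v : 'I_n -> R, (forall i, 0 < v i) &
  forall i, \sum_j A i j * v j = r * v i.
Proof.
pose E : set R := [set l | exists2 x, simplex x &
  forall i, l * x 0 i <= F (fun j => x 0 j) i].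
have simplex_neq0 : simplex !=set0.
  pose i0 := Ordinal n_gt0; exists (delta_mx 0 i0); split => [i|].
    by rewrite mxE eqxx/=; case: (i == i0).
  rewrite (bigD1 i0)//= mxE !eqxx big1 ?addr0// => i /negPf ni.
  by rewrite mxE eqxx ni.
have E0 : E 0.
  by case: simplex_neq0 => x sx; exists x => // i; rewrite mul0r F_ge0//; case: sx.
have ubE : ubound E (\sum_i \sum_j A i j).
  move=> l [x sx lx]; rewrite -[l]mulr1; case: (sx) => _ <-.
  rewrite mulr_sumr; apply: ler_sum => i _; apply: le_trans (lx i) _.
  by apply: ler_sum => j _; rewrite ler_piMr// simplex_le1.
have supE : has_sup E by split; [exists 0|exists (\sum_i \sum_j A i j)].
pose s := sup E.
have s0 : 0 <= s by apply: sup_upper_bound.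

pose gap i (x : 'rV[R]_n) : R := \sum_j (s *+ (j == i) - A i j) * x 0 j.
have gapE i x : gap i x = s * x 0 i - F (fun j => x 0 j) i.
  rewrite /gap; under eq_bigr do rewrite mulrBl.
  rewrite sumrB; congr (_ - _); rewrite (bigD1 i)//= eqxx big1 ?addr0//.
  by move=> j /negPf ->; rewrite mulr0n mul0r.
(* [psi x = 0] exactly when [s x <= A x] entrywise. *)
pose psi x := \sum_i (`|gap i x| + gap i x).
have psi_cont : continuous psi.
  apply: (@continuous_sum _ _ _ _ (fun i x => `|gap i x| + gap i x)) => i.
  by apply: continuous_norm_add; exact: continuous_sum_coord.
have [x xS psi_min] := compact_EVT_min simplex_neq0 compact_simplex
  (continuous_subspaceT psi_cont).
have sx : simplex x by rewrite inE in xS.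
have norm_add_ge0 (a : R) : 0 <= `|a| + a.
  by rewrite -lerBlDr sub0r -normrN ler_norm.
have psi_ge0 y : 0 <= psi y by apply: sumr_ge0.
have psi_x0 : psi x = 0.
  apply/eqP; rewrite eq_le psi_ge0 andbT leNgt; apply/negP => psi_gt0.
  (* A witness [y] of a near-optimal [l] has gaps at most [(s - l) y_i]; as the [y_i] sum to 1,
     [psi y <= 2 (s - l) < psi x], against minimality. *)
  have e0 : 0 < psi x / 2%:R by rewrite divr_gt0.
  have [l [y sy ly] sl] := sup_adherent e0 supE.
  have : psi y <= \sum_i (2%:R * (s - l)) * y 0 i.
    apply: ler_sum => i _; have y0 : 0 <= y 0 i by case: sy.
    have sl0 : 0 <= s - l by rewrite subr_ge0; apply: sup_upper_bound => //; exists y.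
    have gle : gap i y <= (s - l) * y 0 i by rewrite gapE mulrBl lerD2l lerN2.
    have := mulr_ge0 sl0 y0; rewrite -mulrA.
    by move: gle; case: (ger0P (gap i y)) => ? ? ?; lra.
  rewrite -mulr_sumr; case: (sy) => _ ->; rewrite mulr1 => psi_y.
  have := psi_min y; rewrite inE => /(_ sy).
  move: sl psi_y; rewrite -/s; lra.
have x0 i : 0 <= x 0 i by case: sx.
have xsub i : s * x 0 i <= F (fun j => x 0 j) i.
  move: psi_x0 => /eqP; rewrite psumr_eq0// => /allP /(_ i).
  rewrite mem_index_enum => /(_ isT) /= /eqP.
  rewrite -subr_le0 -gapE; set g := gap i x => h; have := normr_ge0 g.
  by move: h; lra.
pose xx j := x 0 j.
pose z i := F xx i - s * xx i.
have z0 i : 0 <= z i by rewrite subr_ge0.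
have [i1 xi1] : exists i, 0 < xx i.
  apply: contrapT => /forallNP nx; case: sx => _.
  rewrite big1 => [/eqP|i _]; first by rewrite eq_sym oner_eq0.
  by apply/eqP; rewrite eq_le x0 andbT leNgt; exact/negP/nx.
(* [F] commutes with [T], so the defect of an iterate of [x] is the iterate of the defect [z]. *)
have iterTz N i : F (iter N T xx) i - s * iter N T xx i = iter N T z i.
  elim: N i => //= N IH i.
  have TE v : T v i = v i + F v i by [].
  rewrite [T (iter N T z) i]TE [in s * _]TE -IH.
  have -> : F (T (iter N T xx)) i = F (iter N T xx) i + F (F (iter N T xx)) i.
    by rewrite /F -big_split/=; apply: eq_bigr => j _; rewrite mulrDr.
  have -> : F (iter N T z) i = F (F (iter N T xx)) i - s * F (iter N T xx) i.
    rewrite /F mulr_sumr -sumrB; apply: eq_bigr => j _.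
    by rewrite -IH mulrBr mulrCA.
  by ring.
have zE i : z i = 0.
  apply: contrapT => /eqP zi; have [|N posN] := @iterT_pos z z0.
    by exists i; rewrite lt_neqAle eq_sym zi z0.
  have [e e0 eN] := fin_pos_lower_bound posN.
  pose y := iter N T xx.
  have y0 j : 0 <= y j by exact: iterT_ge0.
  have Y0 : 0 < \sum_j y j.
    rewrite lt_neqAle sumr_ge0// andbT eq_sym; apply/negP.
    rewrite psumr_eq0// => /allP yz; have := posN i1.
    rewrite -iterTz -/y (_ : F y i1 = 0) ?sub0r ?oppr_gt0.
      by rewrite ltNge mulr_ge0.
    rewrite /F big1// => j _; have := yz j; rewrite mem_index_enum => /(_ isT)/= /eqP ->.
    by rewrite mulr0.
  (* Once [y] is normalized, its defect is at least this increment and its coordinates are at most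
     1. *)
  suff : E (s + e / \sum_j y j).
    move=> /(sup_upper_bound supE); rewrite -/s gerDl leNgt.
    by rewrite divr_gt0.
  exists (\row_j (y j / \sum_k y k)).
    split => [j|]; first by rewrite mxE divr_ge0// ltW.
    under eq_bigr do rewrite mxE.
    by rewrite -mulr_suml divff// gt_eqF.
  move=> j; set v := \row_j _.
  have -> : F (fun k => v 0 k) j = F y j / \sum_k y k.
    by rewrite /F mulr_suml; apply: eq_bigr => k _; rewrite mxE mulrA.
  rewrite mxE mulrA ler_pM2r ?invr_gt0// mulrDl -lerBrDl.
  have := iterTz N j; rewrite -/y => ->.
  apply: le_trans (eN j); rewrite -mulrA ler_piMr ?(ltW e0)//.
  rewrite ler_pdivrMl// mulr1 (bigD1 j)//= lerDl sumr_ge0//.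
have xeig i : F xx i = s * xx i by apply/eqP; rewrite -subr_eq0; apply/eqP; exact: zE.
exists s, xx => //.
have [|N posN] := @iterT_pos xx x0; first by exists i1.
have iterTx : iter N T xx =1 (fun i => (1 + s) ^+ N * xx i).
  elim: (N) => [|M IH] i /=; first by rewrite mul1r.
  rewrite /T IH /F; under eq_bigr do rewrite IH mulrCA.
  rewrite -mulr_sumr; have := xeig i; rewrite /F => ->.
  by rewrite exprS; ring.
move=> i; have := posN i; rewrite iterTx pmulr_rgt0// exprn_gt0//.
by rewrite ltr_pwDl.
Qed.

End perron.

Section spectral_radius.
Variables (R : realType) (n : nat) (A : 'M[R]_n) (v : 'I_n -> R).
Hypotheses (n_gt0 : (0 < n)%N) (A_ge0 : forall i j, 0 <= A i j).
Hypothesis v_gt0 : forall i, 0 < v i.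

Lemma normc_sum_le (I : Type) (s : seq I) (f : I -> R[i]) :
  Normc.normc (\sum_(i <- s) f i) <= \sum_(i <- s) Normc.normc (f i).
Proof.
elim: s => [|i s IH]; first by rewrite !big_nil Normc.normc0.
by rewrite !big_cons; apply: le_trans (le_normcD _ _) _; rewrite lerD2l.
Qed.

Lemma normc_ge0 (z : R[i]) : 0 <= Normc.normc z.
Proof. by case: z => a b; exact: sqrtr_ge0. Qed.

Lemma normc_real (a : R) : Normc.normc (real_complex R a) = `|a|.
Proof. by rewrite /= expr0n/= addr0 sqrtr_sqr. Qed.

(** [eigenvalue] refers to row vectors; the column eigenvector [v] serves as well, since it makes
    [A - r%:M] singular. *)
Lemma eigenvalue_perron (r : R) :
  (forall i, \sum_j A i j * v j = r * v i) -> eigenvalue A r.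
Proof.
move=> Av; rewrite /eigenvalue /eigenspace kermx_eq0 row_free_unit.
apply/negP => unit.
have : (A - r%:M) *m (\col_i v i) = 0.
  apply/colP => i; rewrite mulmxBl mul_scalar_mx !mxE.
  by under eq_bigr do rewrite mxE; rewrite Av subrr.
move=> /(congr1 (mulmx (invmx (A - r%:M)))); rewrite mulKmx// mulmx0.
move=> /colP /(_ (Ordinal n_gt0)); rewrite !mxE => /eqP.
by rewrite gt_eqF.
Qed.

(** Pairing the moduli of a complex left eigenvector for [z] with the positive right eigenvector [v]
    bounds the modulus of [z] by [r], because the pairing is positive. *)
Lemma spectral_radius_perron (r : R) :
  (forall i, \sum_j A i j * v j = r * v i) -> spectral_radius A = r.
Proof.
move=> Av; have r0 : 0 <= r.
  rewrite -(pmulr_lge0 _ (v_gt0 (Ordinal n_gt0))) -Av.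
  by apply: sumr_ge0 => j _; rewrite mulr_ge0// ltW.
have ub s : (exists2 z : R[i], eigenvalue (map_mx (real_complex R) A) z &
    s = Normc.normc z) -> s <= r.
  move=> [z /eigenvalueP [x xA x0] ->].
  pose a j := Normc.normc (x 0 j).
  have zx j : Normc.normc z * a j <= \sum_i a i * A i j.
    rewrite -Normc.normcM; have /rowP/(_ j) := xA.
    rewrite !mxE => <-; apply: le_trans (normc_sum_le _ _) _.
    apply: ler_sum => i _; rewrite Normc.normcM mxE normc_real ger0_norm//.
  have pos : 0 < \sum_j a j * v j.
    have av j : 0 <= a j * v j by rewrite mulr_ge0 ?normc_ge0// ltW.
    rewrite lt_neqAle sumr_ge0// andbT eq_sym; apply: contraNN x0.
    rewrite psumr_eq0// => /allP h; apply/eqP/rowP => j; rewrite mxE.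
    have := h j; rewrite mem_index_enum => /(_ isT) /=.
    rewrite mulf_eq0 (gt_eqF (v_gt0 j)) orbF => /eqP.
    exact: Normc.eq0_normc.
  rewrite -(ler_pM2r pos) mulr_sumr mulr_sumr.
  apply: (@le_trans _ _ (\sum_j (\sum_i a i * A i j) * v j)).
    by apply: ler_sum => j _; rewrite mulrA ler_wpM2r// ltW.
  under eq_bigr do rewrite mulr_suml.
  rewrite exchange_big/=; apply: ler_sum => i _.
  by under eq_bigr do rewrite -mulrA; rewrite -mulr_sumr Av mulrCA.
have rE : exists2 z : R[i], eigenvalue (map_mx (real_complex R) A) z &
    r = Normc.normc z.
  exists (real_complex R r); last by rewrite normc_real ger0_norm.
  by rewrite eigenvalue_map; exact: eigenvalue_perron.
apply/eqP; rewrite eq_le; apply/andP; split.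
  by apply: ge_sup; [exists r|exact: ub].
by apply: sup_upper_bound => //; split; [exists r|exists r].
Qed.

End spectral_radius.

(** At an index maximizing [v i / u i], a multiple of [u] dominates [v] and touches it; the two
    relations are compared there. *)
Lemma perron_le (R : realType) n (A : 'M[R]_n) (u v : 'I_n -> R) (r l : R) :
  (0 < n)%N -> (forall i j, 0 <= A i j) ->
  (forall i, 0 < u i) -> (forall i, 0 < v i) ->
  (forall i, \sum_j A i j * v j = r * v i) ->
  (forall i, \sum_j A i j * u j <= l * u i) -> r <= l.
Proof.
move=> n0 A0 u0 v0 Av Au.
have [i _ imax] := @arg_maxP _ _ _ (Ordinal n0) xpredT (fun i => v i / u i) isT.
have vle j : v j <= v i / u i * u j.
  by rewrite -ler_pdivrMr//; apply: imax.
rewrite -(ler_pM2r (v0 i)) -Av.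
apply: (@le_trans _ _ (\sum_j A i j * (v i / u i * u j))).
  by apply: ler_sum => j _; rewrite ler_wpM2l.
under eq_bigr do rewrite mulrCA.
rewrite -mulr_sumr; apply: le_trans (ler_wpM2l _ (Au i)) _.
  by rewrite divr_ge0 ?ltW.
by rewrite mulrCA mulfVK// gt_eqF.
Qed.

Lemma perron_ge (R : realType) n (A : 'M[R]_n) (u v : 'I_n -> R) (r l : R) :
  (0 < n)%N -> (forall i j, 0 <= A i j) ->
  (forall i, 0 < u i) -> (forall i, 0 < v i) ->
  (forall i, \sum_j A i j * v j = r * v i) ->
  (forall i, l * u i <= \sum_j A i j * u j) -> l <= r.
Proof.
move=> n0 A0 u0 v0 Av Au.
have [i _ imin] := @arg_minP _ _ _ (Ordinal n0) xpredT (fun i => v i / u i) isT.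
have vge j : v i / u i * u j <= v j.
  by rewrite -ler_pdivlMr//; apply: imin.
rewrite -(ler_pM2r (v0 i)) -Av.
apply: (@le_trans _ _ (\sum_j A i j * (v i / u i * u j))); last first.
  by apply: ler_sum => j _; rewrite ler_wpM2l.
under eq_bigr do rewrite mulrCA.
rewrite -mulr_sumr; apply: le_trans (ler_wpM2l _ (Au i)).
  by rewrite mulrCA mulfVK// gt_eqF.
by rewrite divr_ge0 ?ltW.
Qed.

(** * Euclidean geometry *)

Section euclidean.
Variables (R : realType) (d : nat).
Implicit Types u v w : 'rV[R]_d.

Lemma dotpC u v : dotp u v = dotp v u.
Proof. by apply: eq_bigr => k _; rewrite mulrC. Qed.

Lemma dotpDr u v w : dotp u (v + w) = dotp u v + dotp u w.
Proof. by rewrite -big_split; apply: eq_bigr => k _; rewrite mxE mulrDr. Qed.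

Lemma dotpZr a u v : dotp u (a *: v) = a * dotp u v.
Proof. by rewrite mulr_sumr; apply: eq_bigr => k _; rewrite mxE mulrCA. Qed.

Lemma dotpDl u v w : dotp (u + v) w = dotp u w + dotp v w.
Proof. by rewrite dotpC dotpDr !(dotpC w). Qed.

Lemma dotpZl a u v : dotp (a *: u) v = a * dotp u v.
Proof. by rewrite dotpC dotpZr dotpC. Qed.

Lemma dotpNr u v : dotp u (- v) = - dotp u v.
Proof. by rewrite -scaleN1r dotpZr mulN1r. Qed.

Lemma dotpNl u v : dotp (- u) v = - dotp u v.
Proof. by rewrite dotpC dotpNr dotpC. Qed.

Lemma dotpBr u v w : dotp u (v - w) = dotp u v - dotp u w.
Proof. by rewrite dotpDr dotpNr. Qed.

Lemma dotpBl u v w : dotp (u - v) w = dotp u w - dotp v w.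
Proof. by rewrite dotpDl dotpNl. Qed.

Lemma dotp0r u : dotp u 0 = 0.
Proof. by rewrite -(scale0r 0) dotpZr mul0r. Qed.

Lemma dotp0l u : dotp 0 u = 0.
Proof. by rewrite dotpC dotp0r. Qed.

Lemma dotp_delta u k : dotp u (delta_mx 0 k) = u 0 k.
Proof.
rewrite /dotp (bigD1 k)//= mxE !eqxx mulr1 big1 ?addr0// => l /negPf nl.
by rewrite mxE nl andbF mulr0.
Qed.

Lemma dotp_ge0 u : 0 <= dotp u u.
Proof. by apply: sumr_ge0 => k _; rewrite -expr2 sqr_ge0. Qed.

Lemma enorm_ge0 u : 0 <= enorm u.
Proof. exact: sqrtr_ge0. Qed.

Lemma enorm_sqr u : enorm u ^+ 2 = dotp u u.
Proof. by rewrite sqr_sqrtr// dotp_ge0. Qed.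

Lemma enorm0 : enorm (0 : 'rV[R]_d) = 0.
Proof. by rewrite /enorm dotp0r sqrtr0. Qed.

Lemma coord_le_enorm u k : `|u 0 k| <= enorm u.
Proof.
rewrite -(@ler_pXn2r _ 2)// ?nnegrE ?enorm_ge0// enorm_sqr -normrX.
rewrite ger0_norm ?sqr_ge0// /dotp (bigD1 k)//= -expr2 lerDl.
by apply: sumr_ge0 => l _; rewrite -expr2 sqr_ge0.
Qed.

Lemma enorm_eq0 u : (enorm u == 0) = (u == 0).
Proof.
apply/eqP/eqP => [u0|->]; last exact: enorm0.
apply/rowP => k; rewrite mxE; apply/eqP; rewrite -normr_le0 -u0.
exact: coord_le_enorm.
Qed.

Lemma enorm_gt0 u : (0 < enorm u) = (u != 0).
Proof. by rewrite lt_neqAle enorm_ge0 andbT eq_sym enorm_eq0. Qed.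

Lemma enormZ a u : enorm (a *: u) = `|a| * enorm u.
Proof.
by rewrite /enorm dotpZl dotpZr mulrA -expr2 sqrtrM ?sqr_ge0// sqrtr_sqr.
Qed.

Lemma enormN u : enorm (- u) = enorm u.
Proof. by rewrite -scaleN1r enormZ normrN normr1 mul1r. Qed.

Lemma enormB u v : enorm (u - v) = enorm (v - u).
Proof. by rewrite -enormN opprB. Qed.

Lemma dotp_le_enorm u v : dotp u v <= enorm u * enorm v.
Proof.
have [->|u0] := eqVneq u 0; first by rewrite dotp0l mulr_ge0 ?enorm_ge0.
have [->|v0] := eqVneq v 0; first by rewrite dotp0r mulr_ge0 ?enorm_ge0.
have ab : 0 < enorm u * enorm v by rewrite mulr_gt0 ?enorm_gt0.
have := dotp_ge0 (enorm v *: u - enorm u *: v).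
rewrite dotpBl !dotpBr !dotpZl !dotpZr (dotpC v u) -!enorm_sqr => h.
rewrite -(ler_pM2l ab); lra.
Qed.

Lemma ler_enormD u v : enorm (u + v) <= enorm u + enorm v.
Proof.
rewrite -(@ler_pXn2r _ 2)// ?nnegrE ?addr_ge0 ?enorm_ge0//.
rewrite enorm_sqr dotpDl !dotpDr (dotpC v u) sqrrD -!enorm_sqr.
have := dotp_le_enorm u v; lra.
Qed.

Lemma enorm_le_sum u : enorm u <= \sum_k `|u 0 k|.
Proof.
rewrite -(@ler_pXn2r _ 2)// ?nnegrE ?sumr_ge0 ?enorm_ge0// enorm_sqr.
rewrite expr2 mulr_suml; apply: ler_sum => k _.
apply: le_trans (ler_norm _) _; rewrite normrM ler_wpM2l//.
by rewrite (bigD1 k)//= lerDl sumr_ge0.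
Qed.

Lemma continuous_dotp u : continuous (dotp u).
Proof.
by apply: (@continuous_lincomb _ _ _ _ (fun k => u 0 k) (fun k v => v 0 k)) => k;
  exact: coord_continuous.
Qed.

Lemma continuous_enormB v : continuous (fun u => enorm (u - v)).
Proof.
suff h : continuous (fun u => dotp (u - v) (u - v)).
  by move=> x; exact: (continuous_comp (h x) (@sqrt_continuous _ _)).
apply: (@continuous_sum _ _ _ _ (fun k u => (u - v) 0 k * (u - v) 0 k)) => k.
have c : continuous (fun u => (u - v) 0 k : R).
  rewrite (_ : (fun _ => _) = (fun u => u 0 k - v 0 k)); last first.
    by apply/funext => u; rewrite !mxE.
  move=> u; apply: (@continuousB _ R^o _ (fun u => u 0 k)); last exact: cst_continuous.
  exact: coord_continuous.
by move=> u; apply: continuousM; exact: c.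
Qed.

Lemma bounded_enorm (A : set 'rV[R]_d) M :
  (forall u, A u -> enorm u <= M) -> bounded_set A.
Proof.
move=> AM; exists M; split; first exact: num_real.
move=> N MN u /AM uM /=; rewrite [leLHS]/Num.norm/= mx_normrE.
have M0 : 0 <= M by apply: le_trans (enorm_ge0 _) uM.
apply/bigmax_leP; split => [|[i j] _ /=].
  exact: le_trans M0 (ltW MN).
by rewrite ord1 (le_trans (coord_le_enorm _ _))// (le_trans uM)// ltW.
Qed.

End euclidean.

Lemma expR_convex (R : realType) (a b th : R) : 0 <= th <= 1 ->
  expR ((1 - th) * a + th * b) <= (1 - th) * expR a + th * expR b.
Proof.
move=> /andP[t0 t1]; set w := _ + th * b.
have tangent x : expR w * (1 + (x - w)) <= expR x.
  have -> : expR x = expR w * expR (x - w) by rewrite -expRD; congr expR; ring.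
  rewrite ler_pM2l ?expR_gt0//.
  exact: expR_ge1Dx.
have := lerD (ler_wpM2l (_ : 0 <= 1 - th) (tangent a)) (ler_wpM2l t0 (tangent b)).
rewrite subr_ge0 => /(_ t1); apply: le_trans.
by rewrite le_eqVlt; apply/orP; left; apply/eqP; rewrite /w; ring.
Qed.

(** From [expR y * (1 - y) <= 1] one gets [expR y - 1 - y <= y ^+ 2 / (1 - y)], and [1 - y] is at
    least 1/2. *)
Lemma expR_taylor1 (R : realType) (y : R) : `|y| <= 2^-1 ->
  0 <= expR y - 1 - y <= 2 * y ^+ 2.
Proof.
move=> yle; apply/andP; split.
  by have := expR_ge1Dx y; lra.
have [y1 y2] : - 2^-1 <= y /\ y <= 2^-1 by move: yle; rewrite ler_norml => /andP.
have pos : 0 < 1 - y by lra.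
have h : expR y * (1 - y) <= 1.
  by rewrite -[leRHS](expRxMexpNx_1 y) ler_pM2l ?expR_gt0//; exact: expR_ge1Dx.
have := expR_gt0 y; nra.
Qed.

(** * The Perron eigenvalue of the tilted matrices *)

Section tilted.
Variables (R : realType) (d p : nat) (S : seq 'rV[int]_d).
Variable q : 'rV[int]_d -> 'I_p -> 'I_p -> R.
Hypotheses (p_gt0 : (0 < p)%N) (q_ge0 : forall x i j, 0 <= q x i j).
Hypothesis q_supp : forall x i j, 0 < q x i j -> x \in S.
Hypothesis q_irr : forall P : 'I_p -> Prop, (exists i, P i) ->
  (forall i j x, 0 < q x i j -> P j -> P i) -> forall i, P i.

Local Notation ev t x := (dotp t (int_vec R x)).

Definition tilted_mx (t : 'rV[R]_d) : 'M[R]_p :=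
  \matrix_(i, j) \sum_(x <- S) expR (ev t x) * q x i j.

Definition pf (t : 'rV[R]_d) : R := spectral_radius (tilted_mx t).

(* The Collatz-Wielandt quotient [(tilted_mx t v) i / v i] of [v = exp f]. *)
Definition growth (t : 'rV[R]_d) (f : 'I_p -> R) (i : 'I_p) : R :=
  \sum_(x <- S) \sum_j q x i j * expR (ev t x + f j - f i).

Lemma tilted_mx_growth t f i :
  \sum_j tilted_mx t i j * expR (f j) = growth t f i * expR (f i).
Proof.
rewrite /growth exchange_big mulr_suml/=; apply: eq_bigr => j _.
rewrite mxE !mulr_suml; apply: eq_bigr => x _.
rewrite (mulrC _ (q x i j)) -!mulrA; congr (_ * _).
by rewrite -!expRD; congr expR; ring.
Qed.

Lemma tilted_mx_ge0 t i j : 0 <= tilted_mx t i j.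
Proof.
by rewrite mxE sumr_ge0// => x _; rewrite mulr_ge0// expR_ge0.
Qed.

Lemma growth_term t f i x j : x \in S ->
  q x i j * expR (ev t x + f j - f i) <= growth t f i.
Proof.
have pos y k : 0 <= q y i k * expR (ev t y + f k - f i).
  by rewrite mulr_ge0// expR_ge0.
move=> xS; rewrite /growth (big_rem x)//= (bigD1 j)//=.
set a := _ * _; rewrite -(addrA a) lerDl addr_ge0// sumr_ge0// => y _.
by rewrite sumr_ge0.
Qed.

Lemma tilted_mx_irr t : irreducible_mx (tilted_mx t).
Proof.
move=> P P0 Ppred; apply: q_irr => // i j x qx; apply: Ppred.
rewrite mxE (big_rem x) ?(q_supp qx)//=.
rewrite ltr_pwDl ?mulr_gt0 ?expR_gt0// sumr_ge0// => y _.
by rewrite mulr_ge0// expR_ge0.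
Qed.

Lemma pf_growth t : exists f, forall i, growth t f i = pf t.
Proof.
have [r [v v0 Av]] := perron p_gt0 (@tilted_mx_ge0 t) (@tilted_mx_irr t).
exists (fun i => ln (v i)) => i.
rewrite /pf (spectral_radius_perron p_gt0 (@tilted_mx_ge0 t) v0 Av).
apply: (mulIf (lt0r_neq0 (v0 i))).
have := tilted_mx_growth t (fun i => ln (v i)) i.
rewrite lnK ?posrE// => <-; rewrite -Av.
by apply: eq_bigr => j _; rewrite lnK ?posrE.
Qed.

Let pf_eigen t f : (forall i, growth t f i = pf t) ->
  forall i, \sum_j tilted_mx t i j * expR (f j) = pf t * expR (f i).
Proof. by move=> h i; rewrite tilted_mx_growth h. Qed.

(** With [pf_ge], the Collatz-Wielandt bounds in logarithmic form. *)
Lemma pf_le t g l : (forall i, growth t g i <= l) -> pf t <= l.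
Proof.
move=> gl; have [f /pf_eigen ft] := pf_growth t.
apply: (perron_le p_gt0 (@tilted_mx_ge0 t) _ _ ft (u := fun i => expR (g i))).
- by move=> i; exact: expR_gt0.
- by move=> i; exact: expR_gt0.
- by move=> i; rewrite tilted_mx_growth ler_pM2r ?expR_gt0.
Qed.

Lemma pf_ge t g l : (forall i, l <= growth t g i) -> l <= pf t.
Proof.
move=> gl; have [f /pf_eigen ft] := pf_growth t.
apply: (perron_ge p_gt0 (@tilted_mx_ge0 t) _ _ ft (u := fun i => expR (g i))).
- by move=> i; exact: expR_gt0.
- by move=> i; exact: expR_gt0.
- by move=> i; rewrite tilted_mx_growth ler_pM2r ?expR_gt0.
Qed.

Lemma pf_eq t g l : (forall i, growth t g i = l) -> pf t = l.
Proof.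
move=> gl; apply/eqP; rewrite eq_le; apply/andP; split.
  by apply: (@pf_le _ g) => i; rewrite gl.
by apply: (@pf_ge _ g) => i; rewrite gl.
Qed.

(** Test with the eigenvector at [s]: each exponential changes by a factor of at most
    [expR (D * enorm (t - s))]. *)
Lemma pf_log_lipschitz D t s :
  (forall x, x \in S -> enorm (int_vec R x) <= D) ->
  pf t <= expR (D * enorm (t - s)) * pf s.
Proof.
move=> SD; have [f fs] := pf_growth s.
apply: (@pf_le _ f) => i; rewrite -(fs i) /growth mulr_sumr.
rewrite big_seq [leRHS]big_seq; apply: ler_sum => x xS.
rewrite mulr_sumr; apply: ler_sum => j _.
rewrite mulrCA ler_wpM2l// -expRD ler_expR.
rewrite -lerBlDr (_ : _ - _ = ev (t - s) x); last by rewrite dotpBl; ring.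
apply: le_trans (dotp_le_enorm _ _) _.
by rewrite mulrC ler_wpM2r ?enorm_ge0// SD.
Qed.

(** Test with the geometric mean of the two eigenvectors; after division by the claimed bound,
    convexity of [expR] applies term by term. *)
Lemma pf_log_convex t s a b th : 0 <= th <= 1 ->
  pf t <= expR a -> pf s <= expR b ->
  pf ((1 - th) *: t + th *: s) <= expR ((1 - th) * a + th * b).
Proof.
move=> th01 ta sb; have /andP[th0 th1] := th01.
have [f ft] := pf_growth t; have [g gs] := pf_growth s.
apply: (@pf_le _ (fun i => (1 - th) * f i + th * g i)) => i.
rewrite -[leRHS]mul1r -ler_pdivrMr ?expR_gt0// -expRN.
have hf : growth t f i * expR (- a) <= 1.
  by rewrite ft expRN ler_pdivrMr ?expR_gt0// mul1r.
have hg : growth s g i * expR (- b) <= 1.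
  by rewrite gs expRN ler_pdivrMr ?expR_gt0// mul1r.
apply: (@le_trans _ _ ((1 - th) * (growth t f i * expR (- a)) +
    th * (growth s g i * expR (- b)))); last first.
  have := lerD (ler_wpM2l (_ : 0 <= 1 - th) hf) (ler_wpM2l th0 hg).
  by rewrite subr_ge0 !mulr1 subrK; apply.
rewrite /growth !mulr_suml !mulr_sumr -big_split/=; apply: ler_sum => x _.
rewrite !mulr_suml !mulr_sumr -big_split/=; apply: ler_sum => j _.
rewrite -!mulrA -!expRD (mulrCA (1 - th)) (mulrCA th) -mulrDr ler_wpM2l//.
apply: le_trans (expR_convex _ _ th01); rewrite ler_expR.
by rewrite dotpDl !dotpZl le_eqVlt; apply/orP; left; apply/eqP; ring.
Qed.

End tilted.

(** Subtracting the coordinate [i0] from the generator [M - r] turns the unknown constant of the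
    Poisson equation into a value of the solution. The resulting [N] is injective by the maximum
    principle, and its inverse makes solution and constant linear in [b]. *)
Lemma poisson_equation (R : realFieldType) n (M : 'M[R]_n) (r : R) (i0 : 'I_n) :
  (forall i j, 0 <= M i j) -> irreducible_mx M ->
  (forall i, \sum_j M i j = r) ->
  exists Q : 'M[R]_n, forall (b : 'cV[R]_n) i,
    \sum_j M i j * ((Q *m b) j 0 - (Q *m b) i 0) + b i 0 = (Q *m b) i0 0.
Proof.
move=> M0 irr Mr.
pose N := \matrix_(i, j) (M i j - r *+ (j == i) - (j == i0)%:R).
have NE (z : 'cV[R]_n) i :
    (N *m z) i 0 = \sum_j M i j * (z j 0 - z i 0) - z i0 0.
  rewrite mxE; under eq_bigr do rewrite mxE !mulrBl.
  rewrite !sumrB; congr (_ - _); last first.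
    rewrite (bigD1 i0)//= eqxx mul1r big1 ?addr0// => j /negPf ->.
    by rewrite mul0r.
  under [RHS]eq_bigr do rewrite mulrBr.
  rewrite sumrB -mulr_suml Mr; congr (_ - _).
  rewrite (bigD1 i)//= eqxx big1 ?addr0// => j /negPf ->.
  by rewrite mul0r.
have Ninj (z : 'cV[R]_n) : N *m z = 0 -> z = 0.
  move=> Nz.
  have hz i : \sum_j M i j * (z j 0 - z i 0) = z i0 0.
    by apply/eqP; rewrite -subr_eq0 -NE Nz mxE.
  have [imax _ zmax] := @arg_maxP _ _ _ i0 xpredT (fun i => z i 0) isT.
  have [imin _ zmin] := @arg_minP _ _ _ i0 xpredT (fun i => z i 0) isT.
  have {}zmax j : z j 0 <= z imax 0 by exact: zmax.
  have {}zmin j : z imin 0 <= z j 0 by exact: zmin.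
  (* The sum in [hz] is nonpositive at a maximum of [z] and nonnegative at a minimum. *)
  have z0 : z i0 0 = 0.
    apply/eqP; rewrite eq_le; apply/andP; split.
      rewrite -(hz imax); apply: sumr_le0 => j _.
      by rewrite mulr_ge0_le0// subr_le0 zmax.
    rewrite -(hz imin); apply: sumr_ge0 => j _.
    by rewrite mulr_ge0// subr_ge0 zmin.
  (* Where the maximum is attained every term of the sum vanishes, so it is attained at all
     successors. *)
  have zc i : z i 0 = z imax 0.
    move: i; apply: (irreducible_mx_succ irr); first by exists imax.
    move=> i j Mij zi; have := hz i; rewrite z0 => /eqP.
    rewrite -oppr_eq0 -sumrN psumr_eq0 => [/allP/(_ j)|k _]; last first.
      by rewrite oppr_ge0 mulr_ge0_le0// subr_le0 zi zmax.
    rewrite mem_index_enum => /(_ isT)/=.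
    by rewrite oppr_eq0 mulf_eq0 (gt_eqF Mij)/= subr_eq0 zi => /eqP.
  by apply/colP => i; rewrite mxE zc -(zc i0).
have Nu : N \in unitmx.
  rewrite -unitmx_tr -row_free_unit; apply: inj_row_free => v vN.
  have /Ninj : N *m v^T = 0 by rewrite -[N]trmxK -trmx_mul vN trmx0.
  by move=> /(congr1 trmx); rewrite trmxK trmx0.
exists (- invmx N) => b i.
have := NE (- invmx N *m b) i.
rewrite mulmxA mulmxN mulmxV// mulNmx mul1mx mxE.
by set s := \sum_j _ => h; lra.
Qed.

Section pf_derivative.
Variables (R : realType) (d p : nat) (S : seq 'rV[int]_d).
Variable q : 'rV[int]_d -> 'I_p -> 'I_p -> R.
Hypotheses (p_gt0 : (0 < p)%N) (q_ge0 : forall x i j, 0 <= q x i j).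
Hypothesis q_supp : forall x i j, 0 < q x i j -> x \in S.
Hypothesis q_irr : forall P : 'I_p -> Prop, (exists i, P i) ->
  (forall i j x, 0 < q x i j -> P j -> P i) -> forall i, P i.

Local Notation ev t x := (dotp t (int_vec R x)).
Local Notation gr := (growth S q).
Local Notation pf := (pf S q).

(* Perturb the eigenvector [exp f] to [exp (f + e z)], where [z] solves a Poisson
   equation making all first-order terms of the Collatz-Wielandt quotients equal;
   that common value is linear in [h]. *)
Lemma pf_expansion t : exists g : 'rV[R]_d, forall h, exists K, exists2 dl,
  0 < dl & forall e, `|e| <= dl ->
    0 <= pf (t + e *: h) - pf t - e * dotp g h <= K * e ^+ 2.
Proof.
have [f ft] := pf_growth p_gt0 q_ge0 q_supp q_irr t.
pose i0 := Ordinal p_gt0.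
pose a x i j := q x i j * expR (ev t x + f j - f i).
have a0 x i j : 0 <= a x i j by rewrite mulr_ge0 ?expR_ge0.
(* Conjugating by the eigenvector [expR (f i)] gives all rows the same sum [pf t], as
   [poisson_equation] requires. *)
pose M : 'M[R]_p := \matrix_(i, j) \sum_(x <- S) a x i j.
have M0 i j : 0 <= M i j by rewrite mxE sumr_ge0.
have Mirr : irreducible_mx M.
  move=> P P0 Ppred; apply: q_irr => // i j x qx; apply: Ppred.
  rewrite mxE (big_rem x) ?(q_supp qx)//=.
  by rewrite ltr_pwDl ?mulr_gt0 ?expR_gt0// sumr_ge0.
have Msum i : \sum_j M i j = pf t.
  rewrite -(ft i) /growth exchange_big/=; apply: eq_bigr => j _.
  by rewrite mxE.
have [Q Qb] := poisson_equation i0 M0 Mirr Msum.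
pose b (h : 'rV[R]_d) : 'cV[R]_p :=
  \col_i \sum_(x <- S) \sum_j a x i j * ev h x.
exists (\row_k (Q *m b (delta_mx 0 k)) i0 0) => h.
have bE : b h = \sum_k h 0 k *: b (delta_mx 0 k).
  apply/colP => i; rewrite summxE mxE.
  under [RHS]eq_bigr do rewrite !mxE mulr_sumr.
  rewrite [RHS]exchange_big/=; apply: eq_bigr => x _.
  under [RHS]eq_bigr do rewrite mulr_sumr.
  rewrite [RHS]exchange_big/=; apply: eq_bigr => j _.
  rewrite [dotp h _]/dotp mulr_sumr; apply: eq_bigr => k _.
  by rewrite (dotpC (delta_mx 0 k)) dotp_delta mulrCA.
set l := dotp _ h.
have lE : l = (Q *m b h) i0 0.
  rewrite bE mulmx_sumr summxE; apply: eq_bigr => k _.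
  by rewrite -scalemxAr !mxE mulrC.
pose z i := (Q *m b h) i 0.
pose c x i j := ev h x + z j - z i.
have cE i : \sum_(x <- S) \sum_j a x i j * c x i j = l.
  rewrite lE -(Qb _ i) [X in _ + X]mxE.
  under [X in _ = X + _]eq_bigr do rewrite mxE mulr_suml.
  rewrite [X in _ = X + _]exchange_big/= -big_split/=; apply: eq_bigr => x _.
  rewrite -big_split/=; apply: eq_bigr => j _.
  by rewrite -mulrDr /c; congr (_ * _); rewrite /z; ring.
pose C := \sum_(x <- S) \sum_i \sum_j `|c x i j|.
have C0 : 0 <= C by do 3 (apply: sumr_ge0 => ? _).
have cC x i j : x \in S -> `|c x i j| <= C.
  move=> xS; rewrite /C (big_rem x)//= (bigD1 i)//= (bigD1 j)//=.
  rewrite -!addrA lerDl !addr_ge0// ?sumr_ge0// => *;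
    by rewrite ?sumr_ge0// => *; rewrite sumr_ge0.
(* The radius keeps [e * c x i j] in the range of [expR_taylor1]; its bound is then summed against
   the weights [a], of total [pf t]. *)
exists (2 * C ^+ 2 * pf t), (2 * (C + 1))^-1.
  by rewrite invr_gt0 mulr_gt0// ltr_pwDr.
move=> e elt.
have eC : `|e| * C <= 2^-1.
  have C1 : 0 < C + 1 by rewrite ltr_pwDr.
  have h1 : `|e| * (C + 1) <= 2^-1.
    by rewrite -ler_pdivlMr// -invfM.
  by apply: le_trans h1; rewrite ler_wpM2l// lerDl.
have taylor i : 0 <= gr (t + e *: h) (fun j => f j + e * z j) i - pf t - e * l
    <= 2 * C ^+ 2 * pf t * e ^+ 2.
  have -> : gr (t + e *: h) (fun j => f j + e * z j) i - pf t - e * l =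
      \sum_(x <- S) \sum_j a x i j * (expR (e * c x i j) - 1 - e * c x i j).
    rewrite -(cE i) -(ft i) /growth mulr_sumr -!sumrB; apply: eq_bigr => x _.
    rewrite mulr_sumr -!sumrB; apply: eq_bigr => j _.
    have -> : q x i j * expR (ev (t + e *: h) x + (f j + e * z j) -
        (f i + e * z i)) = a x i j * expR (e * c x i j).
      rewrite /a -mulrA -expRD; congr (_ * expR _).
      by rewrite /c dotpDl dotpZl; ring.
    rewrite -/(a x i j); move: (a x i j) (c x i j) (expR _) => ? ? ?; ring.
  have bnd x j : x \in S -> 0 <= expR (e * c x i j) - 1 - e * c x i j <=
      2 * C ^+ 2 * e ^+ 2.
    move=> xS; have ecC : `|e * c x i j| <= `|e| * C.
      by rewrite normrM ler_wpM2l// cC.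
    have /andP[-> h2] := expR_taylor1 (le_trans ecC eC); apply: le_trans h2 _.
    have := ecC; rewrite -(@ler_pXn2r _ 2)// ?nnegrE ?mulr_ge0//.
    rewrite [X in X <= _]real_normK ?num_real// [leRHS]exprMn real_normK ?num_real//.
    by rewrite -mulrA ler_pM2l// (mulrC (C ^+ 2)).
  apply/andP; split.
    rewrite big_seq; apply: sumr_ge0 => x xS; apply: sumr_ge0 => j _.
    by rewrite mulr_ge0//; case/andP: (bnd x j xS).
  rewrite -(ft i) /growth -mulrA (mulrC _ (e ^+ 2)) mulrA mulr_sumr.
  rewrite big_seq [leRHS]big_seq; apply: ler_sum => x xS.
  rewrite mulr_sumr; apply: ler_sum => j _; rewrite mulrC ler_wpM2r//.
  by case/andP: (bnd x j xS).
apply/andP; split.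
  rewrite -addrA -opprD subr_ge0; apply: (pf_ge p_gt0 q_ge0 q_supp q_irr).
  by move=> i; case/andP: (taylor i) => + _; rewrite -addrA -opprD subr_ge0; exact.
rewrite -addrA -opprD lerBlDr; apply: (pf_le p_gt0 q_ge0 q_supp q_irr).
by move=> i; case/andP: (taylor i) => _; rewrite -addrA -opprD lerBlDr; exact.
Qed.

End pf_derivative.

(** * The level set and its polar *)

Lemma continuous_expR_scale (T : topologicalType) (R : realType) (a : R)
    (f : T -> R) :
  continuous f -> continuous (fun x => expR (a * f x)).
Proof.
move=> fc x; apply: (@continuous_comp _ _ _ (fun y => a * f y) expR).
  by apply: (@cvgM _ _ _ _ (fun=> a)); [exact: cvg_cst|exact: fc].
exact: continuous_expR.
Qed.

Lemma small_quadratic (R : realFieldType) (l K dl eta : R) : 0 < dl -> 0 < eta ->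
  exists2 e, 0 < e & e <= dl /\ e * l + K * e ^+ 2 <= eta.
Proof.
move=> dl0 eta0; have s0 : 0 < `|l| + `|K| + 1 by rewrite ltr_wpDl// addr_ge0.
pose e := Num.min (Num.min dl 1) (eta / (`|l| + `|K| + 1)).
have e0 : 0 < e by rewrite !lt_min dl0 ltr01 divr_gt0.
exists e => //; split; first by rewrite !ge_min lexx.
have e1 : e <= 1 by rewrite !ge_min lexx orbT.
have : e * (`|l| + `|K| + 1) <= eta by rewrite -ler_pdivlMr// !ge_min lexx !orbT.
have h1 : e * l <= e * `|l| by rewrite ler_pM2l// ler_norm.
have h2 : K * e ^+ 2 <= e * `|K|.
  rewrite expr2 mulrA mulrC ler_pM2l//.
  apply: le_trans (ler_norm _) _; rewrite normrM (gtr0_norm e0).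
  by rewrite ler_piMr.
by rewrite !mulrDr mulr1; lra.
Qed.

Section level_set.
Variables (R : realType) (d : nat) (rho : 'rV[R]_d -> R) (D N b : R).
Hypothesis rho_lip : forall t s, rho t <= expR (D * enorm (t - s)) * rho s.
Hypothesis rho_conv : forall t s a b th, 0 <= th <= 1 ->
  rho t <= expR a -> rho s <= expR b ->
  rho ((1 - th) *: t + th *: s) <= expR ((1 - th) * a + th * b).
Hypothesis rho_exp : forall t, exists g : 'rV[R]_d, forall h, exists K, exists2 dl,
  0 < dl & forall e, `|e| <= dl ->
    0 <= rho (t + e *: h) - rho t - e * dotp g h <= K * e ^+ 2.
Hypotheses (b_lt0 : b < 0) (rho0 : rho 0 <= expR b).
Hypothesis rho_bounded : forall t, rho t <= 1 -> enorm t <= N.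

Definition unit_gradient (t : 'rV[R]_d) : 'rV[R]_d :=
  (enorm (gradient rho t))^-1 *: gradient rho t.

Lemma derive_of_expansion t h l K dl : 0 < dl ->
  (forall e, `|e| <= dl -> 0 <= rho (t + e *: h) - rho t - e * l <= K * e ^+ 2) ->
  'D_h (rho : 'rV[R]_d -> R^o) t = l.
Proof.
move=> dl0 H; apply: cvg_lim => //; apply/cvgrPdist_le => /= eps eps0.
have K0 : 0 < `|K| + 1 by rewrite ltr_wpDl.
have m0 : 0 < Num.min dl (eps / (`|K| + 1)) by rewrite lt_min dl0 divr_gt0.
near=> e.
have e0 : e != 0 by near: e; exact: nbhs_dnbhs_neq.
have : `|e| <= Num.min dl (eps / (`|K| + 1)) by near: e; exact: dnbhs0_le.
rewrite le_min => /andP[edl eK].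
have /andP[h1 h2] := H e edl.
rewrite /GRing.scale/= (addrC (e *: h)) distrC.
have -> : e^-1 * (rho (t + e *: h) - rho t) - l =
    e^-1 * (rho (t + e *: h) - rho t - e * l).
  by rewrite [RHS]mulrBr mulKf.
rewrite normrM normfV (ger0_norm h1) ler_pdivrMl ?normr_gt0//.
apply: le_trans h2 _; apply: le_trans (ler_norm _) _.
rewrite normrM normrX expr2 mulrCA ler_wpM2l//.
move: eK; rewrite ler_pdivlMr// => eK.
by apply: le_trans eK; rewrite mulrC ler_wpM2l// lerDl.
Unshelve. all: by end_near. Qed.

Lemma gradient_rho t h : exists K, exists2 dl, 0 < dl & forall e, `|e| <= dl ->
  0 <= rho (t + e *: h) - rho t - e * dotp (gradient rho t) h <= K * e ^+ 2.
Proof.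
have [g gP] := rho_exp t.
suff -> : gradient rho t = g by exact: gP.
apply/rowP => k; rewrite mxE; have [K [dl dl0 H]] := gP (delta_mx 0 k).
by rewrite (derive_of_expansion dl0 H) dotp_delta.
Qed.

Let T : set 'rV[R]_d := [set t | rho t <= 1].

(** Convexity keeps [rho <= 1] on the segment, whereas the expansion keeps [rho] above its tangent
    near [t]. *)
Lemma rho_tangent t s : rho t = 1 -> rho s <= 1 ->
  dotp (gradient rho t) (s - t) <= 0.
Proof.
move=> t1 s1; have [K [dl dl0 H]] := gradient_rho t (s - t).
pose e := Num.min dl 1.
have e0 : 0 < e by rewrite lt_min dl0/=.
have e01 : 0 <= e <= 1 by rewrite ltW// ge_min lexx orbT.
have /H/andP[+ _] : `|e| <= dl by rewrite gtr0_norm// ge_min lexx.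
have -> : t + e *: (s - t) = (1 - e) *: t + e *: s.
  by rewrite scalerBr scalerBl scale1r addrA addrAC.
have := @rho_conv t s 0 0 e e01; rewrite expR0 t1 lexx => /(_ isT s1).
rewrite !mulr0 addr0 expR0 => h1 h2.
by rewrite -(pmulr_rle0 _ e0); lra.
Qed.

(** Log-convexity forces a strict decrease towards the origin, where [rho < 1]. In particular the
    gradient does not vanish on the level set. *)
Lemma gradient_rho_pos t : rho t = 1 -> 0 < dotp (gradient rho t) t.
Proof.
move=> t1; have [K [dl dl0 H]] := gradient_rho t (0 - t).
pose e := Num.min dl 1.
have e0 : 0 < e by rewrite lt_min dl0/=.
have e01 : 0 <= e <= 1 by rewrite ltW// ge_min lexx orbT.
have /H/andP[+ _] : `|e| <= dl by rewrite gtr0_norm// ge_min lexx.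
have -> : t + e *: (0 - t) = (1 - e) *: t + e *: 0.
  by rewrite scaler0 addr0 sub0r scalerN scalerBl scale1r.
have := @rho_conv t 0 0 b e e01; rewrite expR0 t1 lexx => /(_ isT rho0).
rewrite !mulr0 add0r => h1 h2.
have h3 : expR (e * b) < 1 by rewrite expR_lt1 pmulr_rlt0.
rewrite sub0r dotpNr in h2.
by rewrite -(pmulr_rgt0 _ e0); lra.
Qed.

Lemma compact_level : compact T.
Proof.
apply: bounded_closed_compact; first by apply: (@bounded_enorm _ _ _ N) => t /rho_bounded.
(* The Lipschitz bound writes [T] as an intersection of explicit closed sets. *)
have -> : T = \bigcap_(s in [set: 'rV[R]_d])
    ((fun t => expR (D * enorm (t - s))) @^-1` [set x | rho s <= x]).
  apply/seteqP; split=> t /= tT => [s _|].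
    apply: le_trans (rho_lip s t) _.
    by rewrite enormB ler_piMr ?expR_ge0.
  by have := tT t I; rewrite /= subrr enorm0 mulr0 expR0.
apply: closed_bigI => s _; apply: closed_comp; last exact: closed_ge.
move=> t _; apply: continuous_expR_scale; exact: continuous_enormB.
Qed.

Lemma rho_step t h : rho t <= 1 ->
  dotp (gradient rho t) h < 0 \/ rho t < 1 ->
  exists2 e, 0 < e & rho (t + e *: h) <= 1.
Proof.
move=> t1 c; have [K [dl dl0 H]] := gradient_rho t h.
set l := dotp _ h in c H.
case: c => [l0|t1'].
  have nl0 : 0 < - l by rewrite oppr_gt0.
  have [e e0 [edl ek]] := small_quadratic K 0 dl0 nl0.
  exists e => //; have /H/andP[_] : `|e| <= dl by rewrite gtr0_norm.
  have : K * e ^+ 2 <= - (e * l).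
    rewrite mul0r addr0 in ek.
    by rewrite -mulrN expr2 mulrCA ler_pM2l// mulrC.
  by lra.
have t1'' : 0 < 1 - rho t by rewrite subr_gt0.
have [e e0 [edl ek]] := small_quadratic l K dl0 t1''.
exists e => //; have /H/andP[_] : `|e| <= dl by rewrite gtr0_norm.
by move: ek; lra.
Qed.

(** A maximizer of [dotp u] over the sublevel set is a preimage: no descent direction of [rho] there
    can increase [dotp u], so [u] is a nonnegative multiple of the gradient. *)
Lemma unit_gradient_surj : set_surj [set t | rho t = 1] (@usphere R d) unit_gradient.
Proof.
move=> u uu.
have T0 : T !=set0 by exists 0; rewrite /T/= (le_trans rho0)// -expR0 ler_expR ltW.
have [t] := compact_EVT_max T0 compact_level
  (continuous_subspaceT (@continuous_dotp _ _ u)).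
rewrite inE /T/= => tT tmax.
have {}tmax s : rho s <= 1 -> dotp u s <= dotp u t by move=> ?; apply: tmax; rewrite inE.
have uu1 : dotp u u = 1 by rewrite -enorm_sqr uu expr1n.
have t1 : rho t = 1.
  apply/eqP; rewrite eq_le tT/= leNgt; apply/negP => t1.
  have [|e e0 /tmax] := rho_step (h := u) tT; first by right.
  by rewrite dotpDr dotpZr uu1 mulr1 gerDl leNgt e0.
exists t => //; set g := gradient rho t.
have desc h : dotp g h < 0 -> dotp u h <= 0.
  move=> gh; have [|e e0 /tmax] := rho_step (h := h) tT; first by left.
  by rewrite dotpDr dotpZr gerDl pmulr_rle0.
have gg : 0 < dotp g g.
  rewrite lt_neqAle dotp_ge0 andbT eq_sym; apply/negP.
  rewrite -enorm_sqr sqrf_eq0 enorm_eq0 => /eqP g0.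
  by have := gradient_rho_pos t1; rewrite -/g g0 dotp0l ltxx.
pose a := dotp u g / dotp g g; pose w := u - a *: g.
have aE : a * dotp g g = dotp u g by rewrite divfK// gt_eqF.
have gw : dotp g w = 0 by rewrite dotpBr dotpZr aE dotpC subrr.
have w0 : w = 0.
  apply/eqP; rewrite -enorm_eq0 -sqrf_eq0 enorm_sqr eq_le dotp_ge0 andbT.
  rewrite leNgt; apply/negP => W0.
  (* With [e'] this small, [w - e' *: g] is a descent direction along which [dotp u] still
     increases. *)
  have [e' e'0 [_ e'W]] := @small_quadratic R (`|dotp u g| + 1) 0 1 _ ltr01 W0.
  have := @desc (w - e' *: g); rewrite dotpBr dotpZr gw sub0r oppr_lt0.
  move=> /(_ (mulr_gt0 e'0 gg)); rewrite dotpBr dotpZr.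
  have -> : dotp u w = dotp w w.
    by rewrite -[X in dotp X w](subrK (a *: g)) dotpDl dotpZl gw mulr0 addr0.
  have : e' * dotp u g <= e' * `|dotp u g| by rewrite ler_pM2l// ler_norm.
  move: e'W; rewrite mul0r addr0 mulrDr mulr1; lra.
have uE : u = a *: g by apply/eqP; rewrite -subr_eq0 -/w w0.
have a0 : 0 <= a.
  have := desc (- g); rewrite !dotpNr oppr_lt0 oppr_le0 => /(_ gg).
  by rewrite -aE pmulr_lge0.
have g0 : 0 < enorm g by rewrite enorm_gt0 -enorm_eq0 -sqrf_eq0 enorm_sqr gt_eqF.
rewrite /unit_gradient -/g uE; congr (_ *: _).
have := uu; rewrite /usphere/= uE enormZ (ger0_norm a0) => ag.
by apply: (mulIf (lt0r_neq0 g0)); rewrite ag mulVf// gt_eqF.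
Qed.

Lemma unit_gradient_max t s : rho t = 1 -> rho s <= 1 ->
  dotp s (unit_gradient t) <= dotp t (unit_gradient t).
Proof.
move=> t1 s1; rewrite -subr_le0 -dotpBl dotpZr dotpC.
by rewrite mulr_ge0_le0 ?invr_ge0 ?enorm_ge0// rho_tangent.
Qed.

(** Whichever preimage of [u] the pseudo-inverse picks, it maximizes [dotp t u] over the sublevel
    set, so the radial bound on [r] says that [dotp t (r *: u) <= 1] for all such [t]. *)
Lemma level_polar (d_gt0 : (0 < d)%N) v :
  (exists r : R, exists2 u : 'rV[R]_d, usphere u &
    0 <= r <= 1 / dotp ('pinv_(fun=> 0) [set t | rho t = 1] unit_gradient u) u /\
    v = r *: u) <->
  (forall t, rho t <= 1 -> dotp t v <= 1).
Proof.
set tau := 'pinv_(fun=> 0) _ _.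
have tau1 u : usphere u -> rho (tau u) = 1.
  move=> uu; have sub := @surjpinv_image_sub _ _ (fun=> 0) _ _ _ unit_gradient_surj.
  by apply: (sub (tau u)); exists u.
have tauu u : usphere u -> unit_gradient (tau u) = u.
  by move=> uu; apply: (surjpK (fun=> 0) unit_gradient_surj); rewrite inE.
have tau_max u s : usphere u -> rho s <= 1 -> dotp s u <= dotp (tau u) u.
  by move=> uu s1; have := unit_gradient_max (tau1 _ uu) s1; rewrite tauu.
have rho01 : rho 0 < 1 by rewrite (le_lt_trans rho0)// expR_lt1.
(* Since [rho 0 < 1], a small positive multiple of [u] lies in the sublevel set; so the radius is
   not the default inverse of 0. *)
have tau_pos u : usphere u -> 0 < dotp (tau u) u.
  move=> uu; have [|e e0] := rho_step (h := u) (ltW rho01); first by right.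
  rewrite add0r => /(tau_max _ _ uu); rewrite dotpZl -enorm_sqr uu expr1n mulr1.
  exact: lt_le_trans.
split=> [[r [u uu [/andP[r0 rle] ->]]] t t1|vP].
  rewrite dotpZr; apply: le_trans (ler_wpM2l r0 (tau_max _ _ uu t1)) _.
  by move: rle; rewrite ler_pdivlMr// tau_pos.
(* The zero vector has no direction of its own: any unit vector serves, with radius 0. *)
have [->|v0] := eqVneq v 0.
  pose k := Ordinal d_gt0; have uk : usphere (delta_mx 0 k : 'rV[R]_d).
    by rewrite /usphere/= /enorm dotp_delta mxE !eqxx sqrtr1.
  exists 0, (delta_mx 0 k) => //; split; last by rewrite scale0r.
  by rewrite lexx/= divr_ge0// ltW// tau_pos.
have ev0 : 0 < enorm v by rewrite enorm_gt0.
have uu : usphere ((enorm v)^-1 *: v).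
  by rewrite /usphere/= enormZ ger0_norm ?invr_ge0 ?ltW// mulVf// gt_eqF.
exists (enorm v), ((enorm v)^-1 *: v) => //; split.
  rewrite ltW//= ler_pdivlMr ?tau_pos// dotpZr mulrA mulfV ?gt_eqF// mul1r.
  by apply: vP; rewrite tau1.
by rewrite scalerA mulfV ?scale1r// gt_eqF.
Qed.

End level_set.

(** * Loops and the limit shape *)

Lemma dotp_subZ_sqr (R : realType) d (t u : 'rV[R]_d) (a : R) :
  dotp (t - a *: u) (t - a *: u) = dotp t t - a * (2 * dotp t u) + a * (a * dotp u u).
Proof. by rewrite !(dotpBl, dotpBr) !dotpZl !dotpZr (dotpC u t); ring. Qed.

Section int_vec.
Variables (R : realType) (d : nat).
Implicit Types x y : 'rV[int]_d.

Lemma int_vecD x y : int_vec R (x + y) = int_vec R x + int_vec R y.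
Proof. by apply/rowP => k; rewrite !mxE intrD. Qed.

Lemma int_vec0 : int_vec R (0 : 'rV[int]_d) = 0.
Proof. by apply/rowP => k; rewrite !mxE. Qed.

Lemma int_vecMn x n : int_vec R (x *+ n) = n%:R *: int_vec R x.
Proof.
elim: n => [|n IH]; first by rewrite mulr0n scale0r int_vec0.
by rewrite mulrS int_vecD IH mulrS scalerDl scale1r.
Qed.

End int_vec.

Section walk.
Variables (R : numDomainType) (d p : nat).
Variable q : 'rV[int]_d -> 'I_p -> 'I_p -> R.

Fixpoint walk k (i : 'I_p) (x : 'rV[int]_d) (j : 'I_p) : Prop :=
  match k with
  | 0%N => x = 0 /\ i = j
  | k'.+1 => exists y l, 0 < q y i l /\ walk k' l (x - y) j
  end.

Lemma walk_cat k l i j h x y :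
  walk k i x j -> walk l j y h -> walk (k + l) i (x + y) h.
Proof.
elim: k i x => [i x [-> ->]|k IH i x [z [a [qz w]]] w']; first by rewrite add0r.
by exists z, a; split => //; rewrite addrAC; exact: IH.
Qed.

Lemma walk_mulrn k i x n : walk k i x i -> walk (n * k) i (x *+ n) i.
Proof.
move=> w; elim: n => [|n IH]; first by split.
by rewrite mulSn mulrS; exact: walk_cat w IH.
Qed.

End walk.

Section loops.
Variables (R : realType) (d p : nat) (S : seq 'rV[int]_d).
Variable q : 'rV[int]_d -> 'I_p -> 'I_p -> R.
Hypotheses (q_ge0 : forall x i j, 0 <= q x i j).
Hypothesis q_supp : forall x i j, 0 < q x i j -> x \in S.
Hypothesis q_conn : forall i j x, exists2 k, (0 < k)%N & walk q k i x j.
Hypothesis q_sum : forall i, \sum_(x <- S) \sum_j q x i j = 1.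
Variable i0 : 'I_p.

Local Notation ev t x := (dotp t (int_vec R x)).
Local Notation pf := (pf S q).
Local Notation walk := (walk q).

Lemma colors_gt0 : (0 < p)%N.
Proof. by case: (p) i0 => // -[]. Qed.

Lemma q_irr (P : 'I_p -> Prop) : (exists i, P i) ->
  (forall i j x, 0 < q x i j -> P j -> P i) -> forall i, P i.
Proof.
move=> [j Pj] Ppred i; have [k _] := q_conn i j 0.
elim: k i 0 => [i x [_ ->] //|k IH i x [y [l [qy w]]]].
by apply: Ppred qy _; exact: IH w.
Qed.

Lemma pf0 : pf 0 = 1.
Proof.
apply: (@pf_eq _ _ _ _ _ colors_gt0 q_ge0 q_supp (@q_irr) 0 (fun=> 0) 1) => i.
rewrite -(q_sum i).
apply: eq_bigr => x _; apply: eq_bigr => j _.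
by rewrite dotp0l addr0 subr0 expR0 mulr1.
Qed.

Definition max_step : R := \sum_(x <- S) enorm (int_vec R x).

Lemma max_step_ge0 : 0 <= max_step.
Proof. by apply: sumr_ge0 => x _; exact: enorm_ge0. Qed.

Lemma le_max_step x : x \in S -> enorm (int_vec R x) <= max_step.
Proof.
move=> xS; rewrite /max_step (big_rem x)//= lerDl sumr_ge0// => y _.
exact: enorm_ge0.
Qed.

Lemma walk_enorm k i x j : walk k i x j -> enorm (int_vec R x) <= k%:R * max_step.
Proof.
elim: k i x => [i x [-> _]|k IH i x [y [l [qy w]]]].
  by rewrite int_vec0 mul0r enorm0.
rewrite -(subrK y x) int_vecD (le_trans (ler_enormD _ _))// mulrS mulrDl mul1r.
by rewrite addrC lerD ?(IH _ _ w)// le_max_step// (q_supp qy).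
Qed.

(* The smallest such [h] is the value at [t] of the support function of the
   limit shape. *)
Definition drift_le (t : 'rV[R]_d) (h : R) : Prop :=
  forall k x, (0 < k)%N -> walk k i0 x i0 -> ev t x <= k%:R * h.

Definition limit_shape : set 'rV[R]_d :=
  [set v | forall t h, drift_le t h -> dotp t v <= h].

Lemma drift_le_ge0 t h : drift_le t h -> 0 <= h.
Proof.
move=> th; have [k k0 w] := q_conn i0 i0 0.
by have := th k 0 k0 w; rewrite int_vec0 dotp0r pmulr_rge0// ltr0n.
Qed.

Lemma drift_le_trans t h h' : h <= h' -> drift_le t h -> drift_le t h'.
Proof.
by move=> hh' th k x k0 w; apply: le_trans (th k x k0 w) _; rewrite ler_wpM2l.
Qed.

Lemma drift_leZ a t h : 0 <= a -> drift_le t h -> drift_le (a *: t) (a * h).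
Proof. by move=> a0 th k x k0 w; rewrite dotpZl mulrCA ler_wpM2l//; exact: th. Qed.

(** Loops displaced by plus or minus a basis vector bound each coordinate of [t]. With
    [drift_le_ln_pf] this makes the sublevel sets of [pf] bounded. *)
Lemma drift_le_enorm : exists2 N, 0 <= N & forall t h, drift_le t h -> enorm t <= N * h.
Proof.
have coord (s : int) : exists N : 'I_d -> nat, forall k,
    walk (N k) i0 (s *: delta_mx 0 k) i0 /\ (0 < N k)%N.
  suff /choice[N NP] : forall k, exists n : nat,
    walk n i0 (s *: delta_mx 0 k) i0 /\ (0 < n)%N by exists N.
  by move=> k; have [n n0 w] := q_conn i0 i0 (s *: delta_mx 0 k); exists n.
have [Np NpP] := coord 1; have [Nm NmP] := coord (-1).
exists (\sum_k (Np k + Nm k)%:R); first exact: sumr_ge0.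
move=> t h th; have h0 := drift_le_ge0 th.
apply: le_trans (enorm_le_sum _) _; rewrite mulr_suml; apply: ler_sum => k _.
have evE (s : int) : ev t (s *: delta_mx 0 k) = s%:~R * t 0 k.
  rewrite -dotp_delta -dotpZr; congr dotp; apply/rowP => l; rewrite !mxE intrM.
  by congr (_ * _); case: (l == k).
have := th _ _ (NpP k).2 (NpP k).1; have := th _ _ (NmP k).2 (NmP k).1.
rewrite !evE mulN1r mul1r natrD mulrDl.
have := mulr_ge0 (ler0n R (Np k)) h0; have := mulr_ge0 (ler0n R (Nm k)) h0.
by rewrite ler_norml => *; apply/andP; split; lra.
Qed.

Lemma exists_drift : exists2 kap, 0 < kap & forall x i j, 0 < q x i j -> kap <= q x i j.
Proof.
(* Vanishing entries are replaced by 1, so that a finite family of positive numbers remains. *)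
pose w (u : 'I_(size S) * 'I_p * 'I_p) :=
  let a := q (nth 0 S u.1.1) u.1.2 u.2 in if 0 < a then a else 1.
have [|kap kap0 kw] := @fin_pos_lower_bound _ _ w.
  by move=> u; rewrite /w/=; case: ifPn.
exists kap => // x i j qx; have xS := q_supp qx.
have ltS : (index x S < size S)%N by rewrite index_mem.
by have := kw (Ordinal ltS, i, j); rewrite /w/= nth_index// qx.
Qed.

Lemma pf_gt0 t : 0 < pf t.
Proof.
have [f ft] := @pf_growth _ _ _ _ _ colors_gt0 q_ge0 q_supp (@q_irr) t.
have [[//|k] _ [y [l [qy _]]]] := q_conn i0 i0 0.
rewrite -(ft i0); apply: lt_le_trans (growth_term q_ge0 t f i0 l (q_supp qy)).
by rewrite mulr_gt0 ?expR_gt0.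
Qed.

(** A single edge contributes at most [pf t] to the quotient of the eigenvector. The logarithms of
    these bounds telescope along a walk, and [f] cancels on a loop. *)
Lemma drift_le_ln_pf : exists2 C, 0 <= C & forall t, drift_le t (ln (pf t) + C).
Proof.
have [kap kap0 kapq] := exists_drift.
exists `|ln kap| => // t.
have [f ft] := @pf_growth _ _ _ _ _ colors_gt0 q_ge0 q_supp (@q_irr) t.
have pf0 := pf_gt0 t.
have path k i x j : walk k i x j ->
    ev t x + f j - f i <= k%:R * (ln (pf t) - ln kap).
  elim: k i x => [i x [-> ->]|k IH i x [y [l [qy w]]]].
    by rewrite int_vec0 dotp0r add0r subrr mul0r.
  have step : ev t y + f l - f i <= ln (pf t) - ln kap.
    rewrite lerBrDr -ler_expR expRD !lnK ?posrE//.
    rewrite -(ft i); apply: le_trans (growth_term q_ge0 t f i l (q_supp qy)).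
    by rewrite mulrC ler_wpM2r ?expR_ge0// kapq.
  have -> : ev t x = ev t (x - y) + ev t y by rewrite -dotpDr -int_vecD subrK.
  by have := IH _ _ w; rewrite mulrS mulrDl mul1r; move: step; lra.
move=> k x k0 w; have := path _ _ _ _ w; rewrite addrK => /le_trans; apply.
by rewrite ler_wpM2l// lerD2l -normrN ler_norm.
Qed.

Lemma pf_le_drift t h : drift_le t h -> pf t <= expR h.
Proof.
move=> th.
(* The weight of color [i] is the supremum of [t . x - k h] over the walks
   [(k, x)] from [i] to [i0]; it is finite because such walks close up to loops. *)
pose V i : set R := [set r | exists k x, walk k i x i0 /\ r = ev t x - k%:R * h].
have Vsup i : has_sup (V i).
  split.
    by have [k _ w] := q_conn i i0 0; exists (ev t 0 - k%:R * h), k, 0.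
  have [a a0 w] := q_conn i0 i 0; exists (a%:R * h) => _ [k [x [w' ->]]].
  have := th _ _ _ (walk_cat w w'); rewrite add0r addn_gt0 a0 => /(_ isT).
  by rewrite natrD mulrDl lerBlDr.
pose f i := sup (V i).
(* Prepending this edge to a walk from [j] gives a walk from [i]. *)
have edge x i j : 0 < q x i j -> ev t x + f j - f i <= h.
  move=> qx; suff : f j <= f i - ev t x + h by lra.
  apply: ge_sup; first by case: (Vsup j).
  move=> _ [k [y [w ->]]].
  have : V i (ev t (x + y) - k.+1%:R * h).
    exists k.+1, (x + y); split => //; exists x, j; split => //.
    by rewrite addrAC subrr add0r.
  move=> /(sup_upper_bound (Vsup i)); rewrite -/(f i) int_vecD dotpDr mulrS mulrDl.
  by lra.
apply: (@pf_le _ _ _ _ _ colors_gt0 q_ge0 q_supp (@q_irr) _ f) => i.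
rewrite -[leRHS]mulr1 -(q_sum i) mulr_sumr; apply: ler_sum => x _.
rewrite mulr_sumr; apply: ler_sum => j _.
have := q_ge0 x i j; rewrite le_eqVlt => /orP[/eqP <-|qx].
  by rewrite mul0r mulr0.
by rewrite mulrC ler_pM2r// ler_expR edge.
Qed.

(** By homogeneity [t] can be rescaled until its drift bound is [ln m], and [pf_le_drift] then puts
    it in the sublevel set. *)
Lemma polar_sub_limit_shape m v : 1 < m ->
  (forall t, pf t <= m -> dotp t v <= 1) -> limit_shape (ln m *: v).
Proof.
move=> m1 pv t h th; have lm : 0 < ln m by rewrite ln_gt0.
(* As [h] may vanish, the rescaling divides by [h + e]. *)
rewrite dotpZr; apply/ler_addgt0Pr => e e0.
have he : 0 < h + e by rewrite ltr_wpDl// (drift_le_ge0 th).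
have /pf_le_drift : drift_le (ln m / (h + e) *: t) (ln m / (h + e) * (h + e)).
  apply: drift_leZ; first by rewrite divr_ge0// ltW.
  by apply: drift_le_trans th; rewrite lerDl ltW.
rewrite divfK ?gt_eqF// lnK ?posrE ?(lt_trans ltr01)// => /pv.
by rewrite dotpZl mulrAC ler_pdivrMr// mul1r.
Qed.

Lemma limit_shape_sub_polar C m v : 1 < m -> 0 <= C ->
  (forall t, drift_le t (ln (pf t) + C)) -> limit_shape v ->
  forall t, pf t <= m -> dotp t ((ln m + C)^-1 *: v) <= 1.
Proof.
move=> m1 C0 drift Lv t tm; have lm : 0 < ln m by rewrite ln_gt0.
rewrite dotpZr ler_pdivrMl ?ltr_wpDr// mulr1; apply: Lv.
apply: drift_le_trans (drift t); rewrite lerD2r ler_ln ?posrE ?pf_gt0//.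
exact: lt_trans m1.
Qed.

Lemma limit_shape_bounded : exists2 M, 0 <= M & forall v, limit_shape v -> enorm v <= M.
Proof.
exists (\sum_(k < d) max_step); first by apply: sumr_ge0 => k _; exact: max_step_ge0.
move=> v Lv; apply: le_trans (enorm_le_sum _) _; apply: ler_sum => k _.
have loop (k' : nat) x : walk k' i0 x i0 -> `|int_vec R x 0 k| <= k'%:R * max_step.
  by move=> w; apply: le_trans (coord_le_enorm _ _) _; exact: walk_enorm w.
rewrite ler_norml; apply/andP; split.
  rewrite lerNl -dotp_delta dotpC -dotpNl; apply: Lv => k' x _ /loop xb.
  rewrite dotpNl dotpC dotp_delta; apply: le_trans xb.
  by rewrite -normrN ler_norm.
rewrite -dotp_delta dotpC; apply: Lv => k' x _ /loop xb.
by rewrite dotpC dotp_delta; apply: le_trans xb; rewrite ler_norm.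
Qed.

Lemma compact_limit_shape : compact limit_shape.
Proof.
have [M _ LM] := limit_shape_bounded.
apply: bounded_closed_compact; first exact: bounded_enorm LM.
have -> : limit_shape = \bigcap_(th in [set th | drift_le th.1 th.2])
    (dotp th.1 @^-1` [set r | r <= th.2]).
  apply/seteqP; split=> v /= Lv; first by move=> [t h] /= /Lv.
  by move=> t h th; exact: (Lv (t, h)).
apply: closed_bigI => -[t h] _; apply: closed_comp; last exact: closed_le.
by move=> v _; exact: continuous_dotp.
Qed.

(* If no loop average came close to [v], the direction from an almost nearest
   loop average to [v] would be separating, since averages of loops are closed
   under rational convex combinations. *)
Lemma limit_shape_approx v e : limit_shape v -> 0 < e ->
  exists k x, [/\ (0 < k)%N, walk k i0 x i0 & enorm (v - k%:R^-1 *: int_vec R x) < e].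
Proof.
move=> Lv e0; apply: contrapT => far.
pose avg k x : 'rV[R]_d := k%:R^-1 *: int_vec R x.
have {}far k x : (0 < k)%N -> walk k i0 x i0 ->
    e ^+ 2 <= dotp (v - avg k x) (v - avg k x).
  move=> k0 w; rewrite -enorm_sqr ler_pXn2r ?nnegrE ?enorm_ge0 ?(ltW e0)//.
  by rewrite leNgt; apply/negP => ?; apply: far; exists k, x.
pose E : set R := [set r | exists k x, [/\ (0 < k)%N, walk k i0 x i0 &
  r = dotp (v - avg k x) (v - avg k x)]].
have Einf : has_inf E.
  split.
    have [k k0 w] := q_conn i0 i0 0.
    by exists (dotp (v - avg k 0) (v - avg k 0)), k, 0.
  by exists 0 => _ [k [x [_ _ ->]]]; exact: dotp_ge0.
have avg_le k x : (0 < k)%N -> walk k i0 x i0 -> enorm (avg k x) <= max_step.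
  move=> k0 w; rewrite enormZ ger0_norm ?invr_ge0// ler_pdivrMl ?ltr0n//.
  exact: walk_enorm w.
pose B := (2 * max_step) ^+ 2.
have B0 : 0 <= B by exact: sqr_ge0.
have e2 : 0 < e ^+ 2 by rewrite exprn_gt0.
(* Moving from [z] by a fraction [th] towards another average changes the squared distance by a
   first-order term and at most [th ^+ 2 * B]; this [n] makes the latter less than
   [th * (e ^+ 2 / 2)]. *)
have [n nB] : exists n : nat, B / (e ^+ 2 / 2) < n.+1%:R.
  exists (Num.truncn (B / (e ^+ 2 / 2))).
  by have /andP[] := truncn_itv (divr_ge0 B0 (ltW (divr_gt0 e2 (ltr0n _ 2)))).
pose th : R := n.+1%:R^-1.
have th0 : 0 < th by rewrite invr_gt0 ltr0n.
have thB : th * B < e ^+ 2 / 2.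
  by rewrite mulrC ltr_pdivrMr ?ltr0n// mulrC -ltr_pdivrMr// divr_gt0.
have eta0 : 0 < th * (e ^+ 2 / 2) by rewrite mulr_gt0// divr_gt0.
have [_ [k [x [k0 w ->]]] near_inf] := inf_adherent eta0 Einf.
set z := avg k x; pose t := v - z.
(* This half-space excludes [v], whose pairing with [t] exceeds [dotp t z] by at least [e ^+ 2]. *)
suff tz : drift_le t (dotp t z + e ^+ 2 / 2).
  have := Lv _ _ tz; have := far k x k0 w; rewrite -/z -/t.
  have -> : dotp t v = dotp t t + dotp t z by rewrite -dotpDr subrK.
  by lra.
move=> l y l0 w'; rewrite mulrC -ler_pdivrMr ?ltr0n// mulrC -dotpZr -/(avg l y).
(* With [n * l] copies of one loop and [k] of the other, the lengths are in ratio [n] to 1, so the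
   second average has weight [th]. *)
have mixw : walk (n.+1 * k * l) i0 (x *+ (n * l) + y *+ k) i0.
  have -> : (n.+1 * k * l = n * l * k + k * l)%N by rewrite mulSn mulnDl addnC mulnAC.
  by apply: walk_cat; exact: walk_mulrn.
have mixE : avg (n.+1 * k * l)%N (x *+ (n * l) + y *+ k) = z + th *: (avg l y - z).
  rewrite /z /avg /th int_vecD !int_vecMn.
  have kR : k%:R != 0 :> R by rewrite pnatr_eq0 -lt0n.
  have lR : l%:R != 0 :> R by rewrite pnatr_eq0 -lt0n.
  have nR : 1 + n%:R != 0 :> R by rewrite -mulrS pnatr_eq0.
  move: (int_vec R x) (int_vec R y) => X Y; apply/rowP => a; rewrite !mxE.
  rewrite !natrM mulrS; field; rewrite nR kR lR //.
have := inf_lbound Einf.2 (_ : E (dotp (v - (z + th *: (avg l y - z)))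
  (v - (z + th *: (avg l y - z))))).
rewrite -mixE => /(_ (ex_intro _ _ (ex_intro _ _ (And3 _ mixw erefl)))).
rewrite !muln_gt0 k0 l0 => /(_ isT); rewrite mixE.
have -> : v - (z + th *: (avg l y - z)) = t - th *: (avg l y - z) by rewrite opprD addrA.
set u := avg l y - z.
have uB : dotp u u <= B.
  rewrite -enorm_sqr /B ler_pXn2r ?nnegrE ?enorm_ge0 ?mulr_ge0 ?max_step_ge0//.
  apply: le_trans (ler_enormD _ _) _; rewrite enormN.
  by have := avg_le _ _ l0 w'; have := avg_le _ _ k0 w; rewrite -/z; lra.
move: near_inf; rewrite -/z -/t dotp_subZ_sqr => h1 h2.
have h3 : th * (th * dotp u u) <= th * (e ^+ 2 / 2).
  rewrite ler_pM2l//; apply: le_trans (ltW thB); rewrite ler_pM2l//.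
have : th * (2 * dotp t u) <= th * e ^+ 2 by lra.
by rewrite ler_pM2l// [dotp t u]dotpBr; lra.
Qed.

End loops.

(** * Hausdorff convergence *)

Lemma cvg_ereal0 (T : Type) (R : realType) (F : set_system T) {FF : Filter F}
    (f : T -> \bar R) :
  (forall e : R, 0 < e -> \forall x \near F, (0 <= f x <= e%:E)%E) ->
  f @ F --> 0%E.
Proof.
move=> H; apply/fine_cvgP; split.
  apply: filterS (H 1 ltr01) => x /andP[f0 f1].
  by rewrite ge0_fin_numE// (le_lt_trans f1)// ltry.
apply/cvgr0Pnorm_le => e e0; apply: filterS (H e e0) => x /andP[f0 fe] /=.
have ffin : f x \is a fin_num by rewrite ge0_fin_numE// (le_lt_trans fe)// ltry.
by rewrite ger0_norm ?fine_ge0// -lee_fin fineK.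
Qed.

Lemma hausdorff_dist_bounds (R : realType) d (A B : set 'rV[R]_d) (e : R) :
  0 <= e ->
  (forall a, A a -> exists2 b, B b & enorm (a - b) <= e) ->
  (forall b, B b -> exists2 a, A a & enorm (a - b) <= e) ->
  (0 <= hausdorff_dist A B <= e%:E)%E.
Proof.
move=> e0 AB BA; apply/andP; split.
  by apply: le_ereal_inf_tmp => _ [x [x0 _ _] <-]; rewrite lee_fin.
by apply: ereal_inf_lbound; exists e.
Qed.

Section convergence.
Variables (R : realType) (d p : nat) (S : seq 'rV[int]_d).
Variable q : 'rV[int]_d -> 'I_p -> 'I_p -> R.
Hypotheses (q_ge0 : forall x i j, 0 <= q x i j).
Hypothesis q_supp : forall x i j, 0 < q x i j -> x \in S.
Hypothesis q_conn : forall i j x, exists2 k, (0 < k)%N & walk q k i x j.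
Hypothesis q_sum : forall i, \sum_(x <- S) \sum_j q x i j = 1.
Variable i0 : 'I_p.

Local Notation pf := (pf S q).
Local Notation walk := (walk q).
Local Notation L := (limit_shape q i0).

Lemma cvg_polar_limit_shape (K : R -> set 'rV[R]_d) :
  (forall m v, 1 < m -> K m v <-> forall t, pf t <= m -> dotp t v <= 1) ->
  hausdorff_dist (scale_set (ln m) (K m)) L @[m --> +oo%R] --> 0%E.
Proof.
move=> KP; apply: cvg_ereal0 => e e0.
have [C C0 drift] := drift_le_ln_pf q_ge0 q_supp q_conn i0.
have [M M0 LM] := limit_shape_bounded q_supp i0.
near=> m.
have m1 : 1 < m by near: m; exact: nbhs_pinfty_gt.
have lm : 0 < ln m by rewrite ln_gt0.
have CM : C * M <= e * ln m.
  rewrite mulrC -ler_pdivrMl// -ler_expR lnK; last by rewrite posrE (lt_trans ltr01).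
  by near: m; apply: nbhs_pinfty_ge; exact: num_real.
apply: hausdorff_dist_bounds => [|_ [v Kv <-]|v Lv]; first exact: ltW.
  exists (ln m *: v); last by rewrite subrr enorm0 ltW.
  by apply: (polar_sub_limit_shape q_ge0 q_supp q_conn q_sum m1); apply/KP.
(* This shrinks [v] by [ln m / (ln m + C)], hence moves it by at most [C * M / (ln m + C)]. *)
exists (ln m *: ((ln m + C)^-1 *: v)).
  exists ((ln m + C)^-1 *: v) => //; apply/KP => //.
  exact: (limit_shape_sub_polar q_ge0 q_supp q_conn m1 C0 drift Lv).
have lC : 0 < ln m + C by rewrite ltr_wpDr.
rewrite scalerA -[X in _ - X]scale1r -scalerBl enormZ.
have -> : ln m / (ln m + C) - 1 = - (C / (ln m + C)) by field; rewrite gt_eqF.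
rewrite normrN ger0_norm ?divr_ge0 ?(ltW lC)// mulrAC ler_pdivrMr//.
apply: (@le_trans _ _ (C * M)); first by rewrite ler_wpM2l ?LM.
by apply: le_trans CM _; rewrite ler_pM2l// lerDl.
Unshelve. all: by end_near. Qed.

Definition reachable n : set 'rV[int]_d :=
  [set x | exists i, exists2 k, (1 <= k <= n)%N & walk k i0 x i].

(** One return walk per color, of at most [M] steps, closes the walk up to a loop at bounded
    cost. *)
Lemma reachable_near_limit_shape : exists B : R, forall n x, (0 < n)%N ->
  reachable n x -> exists2 b, L b & enorm (n%:R^-1 *: int_vec R x - b) <= B / n%:R.
Proof.
have /choice[l lP] : forall i, exists ly : nat * 'rV[int]_d, walk ly.1 i ly.2 i0.
  by move=> i; have [k _ w] := q_conn i i0 0; exists (k, 0).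
pose M := (\max_i (l i).1)%N.
pose D := max_step R S; have D0 : 0 <= D := max_step_ge0 R S.
exists (M%:R * D + M%:R * D) => n x n0 [i [k /andP[k0 kn] w]].
have lM : ((l i).1 <= M)%N by exact: (@leq_bigmax _ (fun i => (l i).1) i).
set y := (l i).2; have wy : walk (l i).1 i y i0 := lP i.
have n0' : 0 < n%:R :> R by rewrite ltr0n.
have nM : 0 < n%:R + M%:R :> R by rewrite ltr_wpDr.
(* Dividing by [n + M], which may exceed the loop length, stays in [L] because drift bounds are
   nonnegative. *)
exists ((n%:R + M%:R)^-1 *: int_vec R (x + y)).
  move=> t h th; have h0 := drift_le_ge0 q_conn th.
  rewrite dotpZr ler_pdivrMl//.
  apply: le_trans (th _ _ _ (walk_cat w wy)) _; first by rewrite addn_gt0 k0.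
  by rewrite ler_wpM2r// -natrD ler_nat leq_add.
have -> : n%:R^-1 *: int_vec R x - (n%:R + M%:R)^-1 *: int_vec R (x + y) =
    (n%:R + M%:R)^-1 *: ((M%:R / n%:R) *: int_vec R x - int_vec R y).
  rewrite int_vecD; move: (int_vec R x) (int_vec R y) => X Y.
  by apply/rowP => a; rewrite !mxE; field; rewrite !gt_eqF.
rewrite enormZ ger0_norm ?invr_ge0 ?(ltW nM)// ler_pdivrMl//.
apply: le_trans (ler_enormD _ _) _; rewrite enormN enormZ ger0_norm ?divr_ge0//.
have hx : M%:R / n%:R * enorm (int_vec R x) <= M%:R * D.
  rewrite -mulrA ler_wpM2l// ler_pdivrMl//.
  apply: le_trans (walk_enorm q_supp w) _.
  by rewrite ler_wpM2r// ler_nat.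
have hy : enorm (int_vec R y) <= M%:R * D.
  by apply: le_trans (walk_enorm q_supp wy) _; rewrite ler_wpM2r// ler_nat.
apply: le_trans (lerD hx hy) _.
rewrite mulrCA ler_peMr ?addr_ge0 ?mulr_ge0//.
by rewrite ler_pdivlMr// mul1r lerDl.
Qed.

(** Compactness leaves finitely many loops to consider, hence a threshold uniform in [v]. *)
Lemma limit_shape_near_reachable e : 0 < e -> exists B : R, forall n v,
  (0 < n)%N -> B <= n%:R -> L v -> exists2 x, reachable n x &
    enorm (n%:R^-1 *: int_vec R x - v) <= e.
Proof.
move=> e0; have e2 : 0 < e / 2 by rewrite divr_gt0.
pose avg (kx : nat * 'rV[int]_d) : 'rV[R]_d := kx.1%:R^-1 *: int_vec R kx.2.
pose loops := [set kx : nat * 'rV[int]_d | (0 < kx.1)%N /\ walk kx.1 i0 kx.2 i0].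
pose U kx := [set v : 'rV[R]_d | enorm (v - avg kx) < e / 2].
have := @compact_limit_shape _ _ _ _ _ q_supp i0; rewrite compact_cover.
move=> /(_ _ loops U) [||F Floops LF].
- move=> kx _; have -> : U kx = (fun v => enorm (v - avg kx)) @^-1` [set r | r < e / 2].
    by [].
  apply: open_comp; last exact: open_lt.
  by move=> v _; exact: continuous_enormB.
- move=> v Lv; have [k [x [k0 w near]]] := limit_shape_approx q_supp q_conn Lv e2.
  by exists (k, x).
(* Beyond this sum each selected loop has at most [n] steps and displacement of norm at most
   [n * (e / 2)]. *)
exists (\sum_(kx <- finmap.enum_fset F) (kx.1%:R + 2 / e * enorm (int_vec R kx.2))).
move=> n v n0 Bn Lv.
have [[k x] /= kxF vkx] := LF v Lv.
have [/= k0 w] : loops (k, x) by have := Floops _ kxF; rewrite inE.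
have n0' : 0 < n%:R :> R by rewrite ltr0n.
have term_ge0 (ky : nat * 'rV[int]_d) : 0 <= ky.1%:R + 2 / e * enorm (int_vec R ky.2).
  by rewrite addr_ge0// mulr_ge0 ?enorm_ge0// divr_ge0// ltW.
have kxn : k%:R + 2 / e * enorm (int_vec R x) <= n%:R.
  apply: le_trans Bn; rewrite (big_rem (k, x))//= lerDl.
  by apply: sumr_ge0 => ky _; exact: term_ge0.
have kn : (k <= n)%N.
  rewrite -(ler_nat R); apply: le_trans kxn; rewrite lerDl.
  by rewrite mulr_ge0 ?enorm_ge0// divr_ge0// ltW.
have xn : enorm (int_vec R x) <= n%:R * (e / 2).
  have : 2 / e * enorm (int_vec R x) <= n%:R by apply: le_trans kxn; rewrite lerDr.
  by rewrite -ler_pdivlMl ?divr_gt0// invf_div mulrC.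
(* Repeating the loop as often as [n] steps allow leaves an error of at most
   [enorm (int_vec R x) / n]. *)
exists (x *+ (n %/ k)).
  exists i0, (n %/ k * k)%N; last exact: walk_mulrn.
  by rewrite muln_gt0 k0 divn_gt0// kn/= leq_trunc_div.
rewrite int_vecMn scalerA -(subrK (avg (k, x)) (_ *: _)) -addrA.
apply: le_trans (ler_enormD _ _) _; rewrite [leRHS](splitr e) lerD//; last first.
  by rewrite enormB ltW.
rewrite /avg/= -scalerBl enormZ.
have kR : 0 < k%:R :> R by rewrite ltr0n.
have modE : n%:R^-1 * (n %/ k)%:R - k%:R^-1 = - ((n %% k)%:R / (n%:R * k%:R)) :> R.
  have : n%:R = (n %/ k)%:R * k%:R + (n %% k)%:R :> R.
    by rewrite -natrM -natrD -divn_eq.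
  move: ((n %/ k)%:R : R) ((n %% k)%:R : R) => a b nE.
  apply: (mulIf (mulf_neq0 (lt0r_neq0 n0') (lt0r_neq0 kR))).
  rewrite mulNr divfK ?mulf_neq0 ?lt0r_neq0// mulrBl.
  rewrite [X in X - _](_ : _ = a * k%:R); last by field; rewrite lt0r_neq0.
  rewrite [X in _ - X](_ : _ = n%:R); last by field; rewrite lt0r_neq0.
  by rewrite nE; ring.
rewrite modE normrN ger0_norm ?divr_ge0 ?mulr_ge0//.
have modk : (n %% k)%:R <= k%:R :> R by rewrite ler_nat ltnW// ltn_mod.
apply: (@le_trans _ _ (n%:R^-1 * enorm (int_vec R x))).
  rewrite ler_wpM2r ?enorm_ge0// ler_pdivrMr ?mulr_gt0//.
  by rewrite mulrA mulVf ?mul1r// lt0r_neq0.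
by rewrite ler_pdivrMl.
Qed.

Lemma cvg_reachable :
  hausdorff_dist (scale_set n%:R^-1 (int_vec R @` reachable n)) L
    @[n --> \oo] --> 0%E.
Proof.
apply: cvg_ereal0 => e e0.
have [B BP] := reachable_near_limit_shape.
have [B' BP'] := limit_shape_near_reachable e0.
near=> n.
have n0 : (0 < n)%N by near: n; exact: nbhs_infty_gt.
have nB : B / e <= n%:R by near: n; exact: nbhs_infty_ger.
have nB' : B' <= n%:R by near: n; exact: nbhs_infty_ger.
apply: hausdorff_dist_bounds => [|_ [_ [x rx <-] <-]|v Lv]; first exact: ltW.
  have [b Lb bx] := BP n x n0 rx; exists b => //; apply: le_trans bx _.
  by rewrite ler_pdivrMr ?ltr0n// mulrC -ler_pdivrMr.
have [x rx xv] := BP' n v n0 nB' Lv; exists (n%:R^-1 *: int_vec R x) => //.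
by exists (int_vec R x) => //; exists x.
Unshelve. all: by end_near. Qed.

End convergence.

(** * The killed random walk *)

Lemma esum_finite_support (R : realType) (T : choiceType) (s : seq T) (f : T -> R) :
  uniq s -> (forall x, 0 <= f x) -> (forall x, f x != 0 -> x \in s) ->
  \esum_(x in [set: T]) (f x)%:E = (\sum_(x <- s) f x)%:E.
Proof.
move=> us f0 fs.
transitivity (\esum_(x in [set` s]) (f x)%:E).
  rewrite [RHS]esum_mkcond; apply: eq_esum => x _.
  case: ifPn => // xs; congr EFin; apply/eqP; apply: contraNT xs => /fs xs.
  by rewrite inE.
rewrite esum_fset//; last by move=> x _; rewrite lee_fin.
by rewrite -fsbig_seq// sumEFin.
Qed.

Lemma esum_pos (R : realType) (T : choiceType) (f : T -> \bar R) :
  (forall x, 0 <= f x)%E ->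
  (0 < \esum_(x in [set: T]) f x)%E <-> exists x, (0 < f x)%E.
Proof.
move=> f0; split=> [pos|[x fx]].
  apply: contrapT => /forallNP nf; move: pos; rewrite esum1 ?ltxx// => x _.
  by apply/eqP; rewrite eq_le f0 andbT leNgt; exact/negP.
apply: lt_le_trans fx _; apply: esum_ge; exists [set x]; first by split.
by rewrite fsbig_set1.
Qed.

Section killed_walk.
Variables (R : realType) (d p : nat) (c : 'rV[int]_d -> 'I_p -> 'I_p -> R).
Hypothesis c_ge0 : forall x i j, 0 <= c x i j.
Hypothesis sigma_bounds : forall i, (0 < total_weight c i < +oo)%E.
Hypothesis c_finite_support : forall i j, finite_set [set x | c x i j != 0].

Definition transition (x : 'rV[int]_d) (i j : 'I_p) : R :=
  c x i j / fine (total_weight c i).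

Definition steps : seq 'rV[int]_d :=
  finmap.enum_fset (fset_set (\bigcup_(ij in [set: 'I_p * 'I_p])
    [set x | c x ij.1 ij.2 != 0])).

Lemma steps_uniq : uniq steps.
Proof. exact: finmap.fset_uniq. Qed.

Lemma steps_support x i j : c x i j != 0 -> x \in steps.
Proof.
move=> cx; have fin : finite_set (\bigcup_(ij in [set: 'I_p * 'I_p])
    [set x | c x ij.1 ij.2 != 0]).
  by apply: bigcup_finite => // -[k l] _; exact: c_finite_support.
have -> : x \in steps = (x \in \bigcup_(ij in [set: 'I_p * 'I_p])
    [set x | c x ij.1 ij.2 != 0]) := in_fset_set fin x.
by rewrite inE; exists (i, j).
Qed.

Lemma total_weightE i :
  total_weight c i = (\sum_(x <- steps) \sum_j c x i j)%:E.
Proof.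
rewrite /total_weight.
rewrite (@esum_finite_support _ _ [seq (x, j) | x <- steps, j <- index_enum 'I_p]
  (fun yj => c yj.1 i yj.2)).
- by rewrite big_allpairs.
- apply: allpairs_uniq; [exact: steps_uniq|exact: index_enum_uniq|].
  by move=> [? ?] [? ?].
- by move=> yj; exact: c_ge0.
- move=> [x j] /= /steps_support xs; apply/allpairsP; exists (x, j).
  by split => //; rewrite mem_index_enum.
Qed.

Lemma total_weight_gt0 i : 0 < fine (total_weight c i).
Proof. by apply: fine_gt0; exact: sigma_bounds. Qed.

Lemma transition_ge0 x i j : 0 <= transition x i j.
Proof. by rewrite divr_ge0// ltW// total_weight_gt0. Qed.

Lemma transition_steps x i j : 0 < transition x i j -> x \in steps.
Proof.
move=> qx; apply: (@steps_support x i j); apply: contraTneq qx => cx.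
by rewrite /transition cx mul0r ltxx.
Qed.

Lemma transition_sum i : \sum_(x <- steps) \sum_j transition x i j = 1.
Proof.
under eq_bigr do rewrite -mulr_suml.
rewrite -mulr_suml; have := total_weight_gt0 i; rewrite total_weightE/= => s0.
by rewrite divff// gt_eqF.
Qed.

Lemma jumpE m x i j : jump c (fun=> m) x i j = m^-1 * transition x i j.
Proof. by rewrite /jump /transition invfM; ring. Qed.

Lemma laplace_mxE m t : 0 < m ->
  laplace_mx c (fun=> m) t = m^-1 *: tilted_mx steps transition t.
Proof.
move=> m0; apply/matrixP => i j; rewrite !mxE.
rewrite (@esum_finite_support _ _ steps
  (fun x => expR (dotp t (int_vec R x)) * jump c (fun=> m) x i j)).
- by rewrite /= mulr_sumr; apply: eq_bigr => x _; rewrite jumpE mulrCA.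
- exact: steps_uniq.
- move=> x; apply: mulr_ge0; first exact: expR_ge0.
  by rewrite jumpE mulr_ge0 ?transition_ge0// invr_ge0 ltW.
- move=> x; rewrite jumpE => h; apply: (@transition_steps x i j).
  rewrite lt_neqAle transition_ge0 andbT eq_sym; apply: contraNneq h => ->.
  by rewrite !mulr0.
Qed.

Lemma krw_prob_ge0 m n s s' : 1 <= m -> (0 <= krw_prob c (fun=> m) n s s')%E.
Proof.
move=> m1; have m0 : 0 < m by apply: lt_le_trans m1.
elim: n s => [|n IH] s /=; first by rewrite lee_fin; case: (s == s').
apply: esum_ge0 => u _; apply: mule_ge0 => //; rewrite lee_fin.
have jump0 x i j : 0 <= jump c (fun=> m) x i j.
  by rewrite jumpE mulr_ge0 ?transition_ge0// invr_ge0 ltW.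
case: s u => [[x i]|] [[y j]|] //=.
by rewrite subr_ge0 invf_le1.
Qed.

Lemma krw_prob_cemetery m n z : krw_prob c m n None (Some z) = 0%E.
Proof.
elim: n => [//|n IH] /=; apply: esum1 => -[yj|] _ /=; first by rewrite mul0e.
by rewrite IH mule0.
Qed.

(** Killing multiplies each jump by the positive factor [m^-1], and nothing returns from the
    cemetery, so positivity does not see [m]. *)
Lemma krw_prob_gt0 m n x i y j : 1 <= m ->
  (0 < krw_prob c (fun=> m) n (Some (x, i)) (Some (y, j)))%E <->
  walk transition n i (y - x) j.
Proof.
move=> m1; have m0 : 0 < m by apply: lt_le_trans m1.
elim: n x i => [|n IH] x i /=.
  rewrite lte_fin ltr0n lt0b; split => [/eqP[-> ->]|[/eqP + ->]].
    by rewrite subrr.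
  by rewrite subr_eq0 => /eqP ->.
have step_ge0 u : (0 <= (krw_step c (fun=> m) (Some (x, i)) u)%:E *
    krw_prob c (fun=> m) n u (Some (y, j)))%E.
  apply: mule_ge0; last exact: krw_prob_ge0.
  rewrite lee_fin; case: u => [[z l]|] /=; last by rewrite subr_ge0 invf_le1.
  by rewrite jumpE mulr_ge0 ?transition_ge0// invr_ge0 ltW.
rewrite esum_pos//; split => [[[[z l]|]]|[z [l [qz w]]]].
- move=> /= pos; exists (z - x), l.
  have prob0 := krw_prob_ge0 n (Some (z, l)) (Some (y, j)) m1.
  split.
    rewrite lt_neqAle transition_ge0 andbT eq_sym; apply: contraTneq pos => q0.
    by rewrite jumpE q0 mulr0 mul0e ltxx.
  rewrite opprB addrA subrK; apply/IH.
  rewrite lt_neqAle prob0 andbT eq_sym; apply: contraTneq pos => ->.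
  by rewrite mule0 ltxx.
- by rewrite krw_prob_cemetery mule0 ltxx.
- exists (Some (x + z, l)); apply: mule_gt0.
    by rewrite lte_fin /= jumpE addrAC subrr add0r mulr_gt0// invr_gt0.
  by apply/IH; rewrite opprD addrA.
Qed.

Lemma reachedE m i0 n : 1 < m ->
  reached c (fun=> m) i0 n = reachable transition i0 n.
Proof.
move=> m1; apply/seteqP; split=> x [i [k kn h]]; exists i, k => //.
  by move: h => /(krw_prob_gt0 _ _ _ _ _ (ltW m1)); rewrite subr0.
by apply/(krw_prob_gt0 _ _ _ _ _ (ltW m1)); rewrite subr0.
Qed.

End killed_walk.

Section sandpile.
Variables (R : realType) (d p : nat) (c : 'rV[int]_d -> 'I_p -> 'I_p -> R).
Hypothesis c_ge0 : forall x i j, 0 <= c x i j.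
Hypothesis sigma_bounds : forall i, (0 < total_weight c i < +oo)%E.
Hypothesis c_finite_support : forall i j, finite_set [set x | c x i j != 0].
Hypothesis conn : forall i j x,
  exists2 k, (0 < k)%N & walk (transition c) k i x j.
Hypotheses (d_gt0 : (0 < d)%N) (p_gt0 : (0 < p)%N).

Let q_ge0 := transition_ge0 c_ge0 sigma_bounds.
Let q_supp := transition_steps c_finite_support.
Let q_sum := transition_sum c_ge0 sigma_bounds c_finite_support.
Local Notation pf := (pf (steps c) (transition c)).

Lemma rhoE m t : 0 < m -> rho c (fun=> m) t = m^-1 * pf t.
Proof.
move=> m0; have [f ft] := pf_growth p_gt0 q_ge0 q_supp (q_irr conn) t.
rewrite /rho laplace_mxE//.
apply: (@spectral_radius_perron _ _ _ (fun i => expR (f i))) => //.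
- by move=> i j; rewrite mxE mulr_ge0 ?invr_ge0 ?(ltW m0)// tilted_mx_ge0.
- by move=> i; exact: expR_gt0.
move=> i; under eq_bigr do rewrite mxE -mulrA.
by rewrite -mulr_sumr tilted_mx_growth ft mulrA.
Qed.

Lemma rho_le1 m t : 0 < m -> (rho c (fun=> m) t <= 1) = (pf t <= m).
Proof. by move=> m0; rewrite rhoE// ler_pdivrMl// mulr1. Qed.

Lemma sandpile_shape_polar m v : 1 < m -> sandpile_shape c (fun=> m) v <->
  forall t, pf t <= m -> dotp t v <= 1.
Proof.
move=> m1; have m0 : 0 < m := lt_trans ltr01 m1.
have mE : expR (ln m) = m by rewrite lnK.
pose i0 := Ordinal p_gt0.
have [N N0 drift_enorm] := drift_le_enorm conn i0.
have [C C0 drift] := drift_le_ln_pf q_ge0 q_supp conn i0.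
have rho_le a t : rho c (fun=> m) t <= expR a -> pf t <= expR (a + ln m).
  by rewrite rhoE// ler_pdivrMl// expRD mE mulrC.
have polar : sandpile_shape c (fun=> m) v <->
    forall t, rho c (fun=> m) t <= 1 -> dotp t v <= 1.
  (* The drift is at most [ln m + C] on the sublevel set, which bounds norms through [N]; and
     [rho 0 = m^-1 = expR (- ln m)]. *)
  apply: (@level_polar _ _ _ (max_step R (steps c)) (N * (ln m + C)) (- ln m)).
  - move=> t s; rewrite !rhoE// mulrCA ler_pM2l ?invr_gt0//.
    apply: (pf_log_lipschitz p_gt0 q_ge0 q_supp (q_irr conn)) => x.
    exact: le_max_step.
  - move=> t s a b th th01 /rho_le ta /rho_le sb.
    rewrite rhoE// ler_pdivrMl// -{1}mE -expRD.
    have := pf_log_convex p_gt0 q_ge0 q_supp (q_irr conn) th01 ta sb.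
    by move=> /le_trans; apply; rewrite ler_expR le_eqVlt; apply/orP; left;
      apply/eqP; ring.
  - move=> t; have [g gP] := pf_expansion p_gt0 q_ge0 q_supp (q_irr conn) t.
    exists (m^-1 *: g) => h; have [K [dl dl0 H]] := gP h.
    exists (m^-1 * K), dl => // e /H /andP[h1 h2]; rewrite !rhoE//.
    rewrite dotpZl (mulrCA e) -!mulrBr -mulrA.
    by rewrite mulr_ge0 ?invr_ge0 ?(ltW m0)//= ler_pM2l// invr_gt0.
  - by rewrite oppr_lt0 ln_gt0.
  - by rewrite rhoE// (pf0 q_ge0 q_supp conn q_sum i0) mulr1 expRN mE.
  - move=> t; rewrite rho_le1// => tm; apply: drift_enorm.
    apply: drift_le_trans (drift t); rewrite lerD2r ler_ln ?posrE//.
    exact: (pf_gt0 q_ge0 q_supp conn i0).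
  - exact: d_gt0.
split=> [sv t|H].
  by rewrite -(rho_le1 t m0); exact: (polar.1 sv).
apply: (polar.2 _) => t; rewrite (rho_le1 t m0); exact: H.
Qed.

End sandpile.

Theorem theorem40 (R : realType) (d p : nat) (hd : (1 <= d)%N) (hp : (1 <= p)%N)
    (c : 'rV[int]_d -> 'I_p -> 'I_p -> R)
    (c_ge0 : forall x i j, 0 <= c x i j)
    (sigma_bounds : forall i, (0 < total_weight c i < +oo)%E)
    (c_finite_support : forall i j, finite_set [set x | c x i j != 0])
    (hA : forall m : R, 1 < m -> assumptionA c (fun=> m))
    (i0 : 'I_p) :
  exists L : set 'rV[R]_d,
    [/\ compact L,
        hausdorff_dist (scale_set (ln m) (sandpile_shape c (fun=> m))) L
          @[m --> +oo%R] --> 0%E &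
        forall m : R, 1 < m ->
          hausdorff_dist
            (scale_set n%:R^-1 (int_vec R @` reached c (fun=> m) i0 n)) L
          @[n --> \oo] --> 0%E].
Proof.
have conn i j x : exists2 k, (0 < k)%N & walk (transition c) k i x j.
  (* Connectivity is the same for all [m > 1]; the value 2 is an arbitrary choice. *)
  have m1 : (1 : R) < 2 by rewrite ltr1n.
  have [k k0 pos] := krw_irreducible (hA 2 m1) i j x; exists k => //.
  by have := (krw_prob_gt0 c_ge0 sigma_bounds _ _ _ _ _ (ltW m1)).1 pos; rewrite subr0.
have q_ge0 := transition_ge0 c_ge0 sigma_bounds.
have q_supp := transition_steps c_finite_support.
have q_sum := transition_sum c_ge0 sigma_bounds c_finite_support.
exists (limit_shape (transition c) i0); split.
- exact: (@compact_limit_shape _ _ _ _ _ q_supp i0).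
- apply: (cvg_polar_limit_shape q_ge0 q_supp conn q_sum) => m v m1.
  exact: sandpile_shape_polar.
- move=> m m1; have -> : reached c (fun=> m) i0 = reachable (transition c) i0.
    by apply/funext => n; exact: reachedE.
  exact: (cvg_reachable q_supp conn).
Qed.
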